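(* Let $\Omega$ be a bounded convex set in $\mathbb{R}^n$ with non-empty interior, and let $\chi_\Omega$ be its characteristic function. The Poisson integral $$P\chi_\Omega(x,t) = \frac{2t}{\sigma_n(S^n)}\int_{\mathbb{R}^n} \left(|x-y|^2+t^2\right)^{-(n+1)/2}\chi_\Omega(y)\,\mathrm{d}y,\quad (x,t)\in\mathbb{R}^n\times(0,+\infty),$$ is strictly $1$-parabolically quasi-concave on $\mathbb{R}^n\times(0,+\infty)$.
   Context: $S^n$ is the $n$-dimensional unit sphere (in $\mathbb{R}^{n+1}$) and $\sigma_n$ is the $n$-dimensional spherical Lebesgue measure. Write $x_\lambda=(1-\lambda)x_0+\lambda x_1$ and $t_\lambda=(1-\lambda)t_0+\lambda t_1$. A non-negative function $\varphi$ on $\mathbb{R}^n\times(0,+\infty)$ is $1$-parabolically quasi-concave if $\varphi(x_\lambda,t_\lambda)\geq\min\{\varphi(x_0,t_0),\varphi(x_1,t_1)\}$ for all $(x_0,t_0),(x_1,t_1)\in\mathbb{R}^n\times(0,+\infty)$ and $\lambda\in[0,1]$. It is strictly $1$-parabolically quasi-concave if moreover this inequality is strict whenever $(x_0,t_0)\neq(x_1,t_1)$ and $\lambda\in(0,1)$. *)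

(* Defs.v *)
From HB Require Import structures.
From mathcomp Require Import all_boot all_order all_algebra.
From mathcomp Require Import all_classical all_reals all_analysis.

Set Implicit Arguments.
Unset Strict Implicit.
Unset Printing Implicit Defensive.

Import Order.TTheory GRing.Theory Num.Theory.
Import numFieldNormedType.Exports.

Local Open Scope classical_set_scope.
Local Open Scope ring_scope.

(* The product (= Borel) sigma-algebra on 'rV[R]_n, generated by the coordinates,
   built as the library does for n.-tuple T. *)
Definition measure_rV_display : measure_display -> measure_display.
Proof. exact. Qed.

Section measurable_rV.
Variables (R : realType) (n : nat).

Let coors (i : 'I_n) (x : 'rV[R]_n) : R := x ord0 i.

Let rV_set0 : g_sigma_preimage coors set0.
Proof. exact: sigma_algebra0. Qed.

Let rV_setC A : g_sigma_preimage coors A -> g_sigma_preimage coors (~` A).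
Proof. exact: sigma_algebraC. Qed.

Let rV_bigcup (F : (set _)^nat) : (forall i, g_sigma_preimage coors (F i)) ->
  g_sigma_preimage coors (\bigcup_i (F i)).
Proof. exact: sigma_algebra_bigcup. Qed.

HB.instance Definition _ := @isMeasurable.Build
  (measure_rV_display default_measure_display)
  'rV[R]_n (g_sigma_preimage coors) rV_set0 rV_setC rV_bigcup.

End measurable_rV.

Section rV_cons.
Variables (R : realType) (n : nat).

Definition rV_cons (p : R * 'rV[R]_n) : 'rV[R]_n.+1 :=
  \row_i oapp (p.2 ord0) p.1 (unlift ord0 i).

Definition rV_uncons (x : 'rV[R]_n.+1) : R * 'rV[R]_n :=
  (x ord0 ord0, \row_i x ord0 (lift ord0 i)).

Lemma rV_consK : cancel rV_cons rV_uncons.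
Proof.
case=> a v; rewrite /rV_uncons/= mxE unlift_none; congr pair.
by apply/rowP => i; rewrite !mxE liftK.
Qed.

Lemma rV_unconsK : cancel rV_uncons rV_cons.
Proof.
by move=> x; apply/rowP => i; rewrite mxE; case: unliftP => [j|] ->//=; rewrite mxE.
Qed.

End rV_cons.

Lemma measurable_rV_coord (R : realType) n (i : 'I_n) :
  measurable_fun setT (fun x : 'rV[R]_n => x ord0 i).
Proof.
move=> _ Y mY; rewrite setTI; apply: sub_sigma_algebra => /=.
rewrite -bigcup_seq/=; exists i => /=; first by rewrite mem_index_enum.
by exists Y => //; rewrite setTI.
Qed.

Lemma measurable_fun_rV (R : realType) n d (T : measurableType d)
    (f : T -> 'rV[R]_n) :
  (forall i, measurable_fun setT (fun t => f t ord0 i)) ->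
  measurable_fun setT f.
Proof.
move=> mf.
apply: (@measurability _ _ _ _ setT f
  (\big[setU/set0]_(i < n) preimage_set_system setT
     (fun x : 'rV[R]_n => x ord0 i) measurable)) => //.
move=> _ [B + <-]; rewrite -bigcup_seq => -[i _ [A mA <-]].
by rewrite setTI; apply: mf.
Qed.

Lemma measurable_rV_cons (R : realType) n : measurable_fun setT (@rV_cons R n).
Proof.
apply: measurable_fun_rV => i; rewrite /rV_cons.
have [j ->|->] := unliftP ord0 i.
  rewrite (_ : (fun _ => _) = (fun x : 'rV[R]_n => x ord0 j) \o snd).
    exact: measurableT_comp (measurable_rV_coord j) measurable_snd.
  by apply/funext => p; rewrite mxE liftK.
rewrite (_ : (fun _ => _) = fst); first exact: measurable_fst.
by apply/funext => p; rewrite mxE unlift_none.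
Qed.

Lemma measurable_rV_uncons (R : realType) n :
  measurable_fun setT (@rV_uncons R n).
Proof.
apply: measurable_fun_pair => /=; first exact: measurable_rV_coord.
apply: measurable_fun_rV => i.
rewrite (_ : (fun _ => _) = (fun x : 'rV[R]_n.+1 => x ord0 (lift ord0 i))).
  exact: measurable_rV_coord.
by apply/funext => x; rewrite mxE.
Qed.

Section rV_prod_measure.
Local Open Scope ereal_scope.
Variables (R : realType) (n : nat).
Variable m : {sigma_finite_measure set 'rV[R]_n -> \bar R}.

(* The measure lebesgue_measure \x m, transported from R * R^n to R^n.+1. *)
Definition rV_prod : set 'rV[R]_n.+1 -> \bar R :=
  pushforward (lebesgue_measure \x m) (@rV_cons R n).

Let rV_prod0 : rV_prod set0 = 0.
Proof. by rewrite /rV_prod /pushforward preimage_set0 measure0. Qed.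

Let rV_prod_ge0 A : 0 <= rV_prod A.
Proof. exact: (measure_ge0 (lebesgue_measure \x m)). Qed.

Let rV_prod_sigma_additive : semi_sigma_additive rV_prod.
Proof.
move=> F mF tF mUF; rewrite /rV_prod /pushforward preimage_bigcup.
have mcons k : measurable (@rV_cons R n @^-1` F k).
  by rewrite -[X in measurable X]setTI; exact: measurable_rV_cons.
apply: measure_semi_sigma_additive => //.
- apply/trivIsetP => /= i j _ _ ij; rewrite -preimage_setI.
  by move/trivIsetP : tF => /(_ _ _ _ _ ij) ->//; rewrite preimage_set0.
- exact: bigcupT_measurable.
Qed.

HB.instance Definition _ := isMeasure.Build _ _ _ rV_prod
  rV_prod0 rV_prod_ge0 rV_prod_sigma_additive.

Let rV_prod_sigma_finite : sigma_finite setT rV_prod.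
Proof.
have /sigma_finiteP[F [TF ndF Foo]] := sigma_finiteT (@lebesgue_measure R).
have /sigma_finiteP[G [TG ndG Goo]] := sigma_finiteT m.
exists (fun k => @rV_uncons R n @^-1` (F k `*` G k)).
  apply/esym; rewrite -preimage_bigcup -subTset => x _ /=.
  have [k _ Fk] : (\bigcup_k F k) (rV_uncons x).1 by rewrite -TF.
  have [l _ Gl] : (\bigcup_k G k) (rV_uncons x).2 by rewrite -TG.
  exists (maxn k l) => //; split.
  - by move: Fk; exact/subsetPset/ndF/leq_maxl.
  - by move: Gl; exact/subsetPset/ndG/leq_maxr.
move=> k; have [mF Fk] := Foo k; have [mG Gk] := Goo k.
have mFG : measurable (F k `*` G k) by exact: measurableX.
split.
  by rewrite -[X in measurable X]setTI; exact: measurable_rV_uncons.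
rewrite /rV_prod /pushforward -comp_preimage.
rewrite (_ : _ \o _ = id) ?preimage_id; last first.
  by apply/funext => p /=; rewrite rV_consK.
by rewrite product_measure1E// lte_mul_pinfty// ge0_fin_numE.
Qed.

HB.instance Definition _ := Measure_isSigmaFinite.Build _ _ _ rV_prod
  rV_prod_sigma_finite.

End rV_prod_measure.

(* The Lebesgue measure on the Borel subsets of R^n. *)
Fixpoint borel_lebesgue_rV (R : realType) (n : nat) :
    {sigma_finite_measure set 'rV[R]_n -> \bar R} :=
  if n is n'.+1 return {sigma_finite_measure set 'rV[R]_n -> \bar R}
  then rV_prod (borel_lebesgue_rV R n') else \d_(0 : 'rV[R]_0).

(* The (complete) Lebesgue measure on R^n. Its sigma-algebra is the one of
   Lebesgue-measurable sets: a convex set is Lebesgue-measurable but need not be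
   Borel when n > 1. *)
Definition lebesgue_rV (R : realType) (n : nat) :=
  @completed_measure_extension _ _ _ (borel_lebesgue_rV R n).

Arguments lebesgue_rV : clear implicits.

HB.instance Definition _ (R : realType) (n : nat) :=
  Measure.on (lebesgue_rV R n).

(* The norm `|x| of the library on 'rV[R]_n is the sup norm. *)
Definition enorm (R : realType) (n : nat) (x : 'rV[R]_n) : R :=
  Num.sqrt (\sum_i x ord0 i ^+ 2).

Definition sphere (R : realType) (n : nat) : set 'rV[R]_n.+1 :=
  [set x | enorm x = 1].

Arguments sphere : clear implicits.

Definition cone (R : realType) (n : nat) (A : set 'rV[R]_n) : set 'rV[R]_n :=
  [set z | exists r x, [/\ 0 <= r <= 1, A x & z = r *: x]].

(* The spherical Lebesgue measure of A `<=` sphere R n, normalised as the surface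
   measure: n.+1 times the volume of the cone over A with apex at the origin. *)
Definition spherical_measure (R : realType) (n : nat)
    (A : set 'rV[R]_n.+1) : \bar R :=
  (n.+1%:R%:E * lebesgue_rV R n.+1 (cone (A `&` sphere R n)))%E.

Definition poisson_integral (R : realType) (n : nat) (f : 'rV[R]_n -> R)
    (x : 'rV[R]_n) (t : R) : R :=
  2 * t / fine (spherical_measure (sphere R n)) *
  \int[lebesgue_rV R n]_y
    ((enorm (x - y) ^+ 2 + t ^+ 2) `^ (- (n.+1%:R / 2)) * f y).

(* Functions on R^n * (0, +oo) are represented by total functions of (x, t), of
   which only the values for t > 0 matter. *)
Definition parabolically1_quasi_concave (R : realType) (n : nat)
    (phi : 'rV[R]_n -> R -> R) : Prop :=
  (forall x t, 0 < t -> 0 <= phi x t) /\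
  forall (x0 x1 : 'rV[R]_n) (t0 t1 lambda : R),
    0 < t0 -> 0 < t1 -> 0 <= lambda <= 1 ->
    Num.min (phi x0 t0) (phi x1 t1) <=
    phi ((1 - lambda) *: x0 + lambda *: x1) ((1 - lambda) * t0 + lambda * t1).

Definition strictly_parabolically1_quasi_concave (R : realType) (n : nat)
    (phi : 'rV[R]_n -> R -> R) : Prop :=
  parabolically1_quasi_concave phi /\
  forall (x0 x1 : 'rV[R]_n) (t0 t1 lambda : R),
    0 < t0 -> 0 < t1 -> (x0, t0) <> (x1, t1) -> 0 < lambda < 1 ->
    Num.min (phi x0 t0) (phi x1 t1) <
    phi ((1 - lambda) *: x0 + lambda *: x1) ((1 - lambda) * t0 + lambda * t1).

(* Main.v *)
Require Import Defs.
From HB Require Import structures.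
From mathcomp Require Import all_boot all_order all_algebra.
From mathcomp Require Import all_classical all_reals all_analysis.
From mathcomp Require Import measurable_realfun ring lra.

Set Implicit Arguments.
Unset Strict Implicit.
Unset Printing Implicit Defensive.

Import Order.TTheory GRing.Theory Num.Theory.
Import numFieldNormedType.Exports.

Local Open Scope classical_set_scope.
Local Open Scope ring_scope.

(* Put q(x, t) = |(x, t)| in R^(n+1), so that the Poisson kernel is a multiple of
   F_(x,t)(y) = t / q(x - y, t)^(n+1). The perspective of u |-> u^(n+1) is convex
   and q is a norm, so F^(-1/n) is jointly convex in (x, t, y); the
   Borell-Brascamp-Lieb inequality with exponent -1/n then bounds the integral
   of F_(x_l,t_l) over a convex set below by the minimum of the integrals of
   F_(x0,t0) and F_(x1,t1). That inequality is proved by Fubini and induction on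
   the dimension, from the one-dimensional Brunn-Minkowski inequality for level
   sets.

   For strictness, the triangle inequality for q gains a factor < 1 at (y0, y1)
   unless (x0 - y0, t0) and (x1 - y1, t1) are parallel. Cut Omega, in one
   coordinate direction, at the same quantile of F_(x0,t0) and of F_(x1,t1), and
   apply the inequality to the two pairs of slabs separately. When
   (x0, t0) <> (x1, t1), some direction +-e_i and some small quantile give a pair
   of lower slabs on which parallelism fails uniformly: otherwise the homothety
   y |-> x1 - (t1 / t0)(x0 - y) would fix both ends of each projection of Omega.
   The gain on that pair makes the total strictly larger than the minimum. *)

(** * One-dimensional inequalities *)

Section perspective.
Context {R : realFieldType}.
Implicit Types (x r w W u v A B al be : R) (k : nat).

(** Convexity of u |-> u^(k+1): its graph lies above the tangent at r. The gap for k+1 is x times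
    the gap for k plus (k+1) r^k (x - r)^2, which drives the induction. *)
Lemma exprS_tangent_le k x r : 0 <= x -> 0 <= r ->
  k.+1%:R * x * r ^+ k <= x ^+ k.+1 + k%:R * r ^+ k.+1.
Proof.
move=> x0 r0; elim: k => [|k IH]; first by rewrite !expr1 expr0; lra.
rewrite -subr_ge0.
have -> : x ^+ k.+2 + k.+1%:R * r ^+ k.+2 - k.+2%:R * x * r ^+ k.+1 =
   x * (x ^+ k.+1 + k%:R * r ^+ k.+1 - k.+1%:R * x * r ^+ k)
   + k.+1%:R * r ^+ k * (x - r) ^+ 2.
  by rewrite !exprS -!natr1; ring.
apply: addr_ge0; first by rewrite mulr_ge0// subr_ge0.
by rewrite mulr_ge0 ?sqr_ge0// mulr_ge0 ?exprn_ge0.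
Qed.

Lemma perspective_tangent k w W r : 0 <= w -> 0 < W -> 0 <= r ->
  (k.+1%:R * w - k%:R * W * r) * r ^+ k <= w ^+ k.+1 / W ^+ k.
Proof.
move=> w0 W0 r0; rewrite -subr_ge0.
rewrite (_ : _ - _ = W * ((w / W) ^+ k.+1 + k%:R * r ^+ k.+1
    - k.+1%:R * (w / W) * r ^+ k)); last first.
  rewrite expr_div_n !exprS -!natr1; field.
  by rewrite ?expf_neq0 gt_eqF.
rewrite mulr_ge0 ?(ltW W0)// subr_ge0 exprS_tangent_le//.
by rewrite divr_ge0// ltW.
Qed.

(** The linear function of (w, W) in [perspective_tangent] supports the perspective w^(k+1) / W^k
    along the ray w = r W. With r the slope of the combined point, the supporting bounds at (u, A)
    and (v, B) add up to exactly the left-hand side. *)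
Lemma perspective_convex k al be u v A B : 0 < al -> 0 < be ->
  0 <= u -> 0 <= v -> 0 < A -> 0 < B ->
  (al * u + be * v) ^+ k.+1 / (al * A + be * B) ^+ k <=
  al * (u ^+ k.+1 / A ^+ k) + be * (v ^+ k.+1 / B ^+ k).
Proof.
move=> al0 be0 u0 v0 A0 B0.
set S := al * A + be * B; set r := (al * u + be * v) / S.
have S0 : 0 < S by rewrite /S addr_gt0// mulr_gt0.
have r0 : 0 <= r by rewrite divr_ge0 ?(ltW S0)// addr_ge0// mulr_ge0// ltW.
have rS : al * u + be * v = r * S by rewrite /r divfK// gt_eqF.
have : al * ((k.+1%:R * u - k%:R * A * r) * r ^+ k) +
       be * ((k.+1%:R * v - k%:R * B * r) * r ^+ k) <=
       al * (u ^+ k.+1 / A ^+ k) + be * (v ^+ k.+1 / B ^+ k).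
  by apply: lerD; rewrite ler_pM2l// perspective_tangent.
apply: le_trans; rewrite rS (_ : _ / _ = r ^+ k * (r * S)); last first.
  by clearbody S r; rewrite exprMn !exprS; field; rewrite expf_neq0 ?gt_eqF.
rewrite le_eqVlt; apply/orP; left; apply/eqP.
transitivity (r ^+ k * (k.+1%:R * (r * S) - k%:R * r * S)).
  by clearbody S r; rewrite -natr1; ring.
by rewrite -rS; clearbody r; rewrite /S; ring.
Qed.

End perspective.

Section affine_lebesgue.
Context {R : realType}.
Local Notation leb := (@lebesgue_measure R).

Lemma measurable_affine (a c : R) :
  measurable_fun [set: R] (fun x : R => a * x + c).
Proof. by apply: measurable_funD => //; exact: measurable_funM. Qed.

Lemma lebesgue_measure_affine (a c : R) (A : set R) : 0 < a -> measurable A ->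
  leb [set a * x + c | x in A] = (a%:E * leb A)%E.
Proof.
move=> a0 mA.
pose phi (x : measurableTypeR R) : measurableTypeR R := a^-1 * x + - (a^-1 * c).
have mphi : measurable_fun [set: measurableTypeR R] phi.
  exact: (measurable_affine a^-1 (- (a^-1 * c))).
have imE B : [set a * x + c | x in B] = phi @^-1` B.
  apply/seteqP; split => [_ [x Bx <-]|y By] /=.
    by rewrite /phi mulrDr mulrA mulVf ?gt_eqF// mul1r addrK.
  by exists (phi y) => //; rewrite /phi mulrDr mulrN !mulrA divff ?gt_eqF//; ring.
have ai0 : 0 <= a^-1 by rewrite invr_ge0 ltW.
(* [mu] sends B to a^-1 times the measure of a B + c. It agrees with Lebesgue measure on half-open
   intervals, hence on all measurable sets. *)
pose mu : {measure set (measurableTypeR R) -> \bar R} :=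
  mscale (NngNum ai0) (pushforward leb phi).
have H : forall X, ocitv X -> leb X = mu mphi X.
  move=> _ [[x y] _ <-] /=.
  rewrite /mu /mscale/= /pushforward.
  rewrite (_ : phi @^-1` _ = `](a * x + c), (a * y + c)]%classic); last first.
    rewrite -imE; apply/seteqP; split => z /=.
      by move=> [w + <-]; rewrite !in_itv/= ltrD2r lerD2r ltr_pM2l// ler_pM2l.
    rewrite !in_itv/= -ltrBrDr -lerBlDr => /andP[h1 h2].
    exists ((z - c) / a); last by rewrite mulrCA divff ?gt_eqF// mulr1 subrK.
    by rewrite in_itv/= ltr_pdivlMr// ler_pdivrMr// mulrC h1 mulrC.
  rewrite !lebesgue_measure_itv/= !lte_fin ltrD2r ltr_pM2l//.
  case: ifPn => _; last by rewrite mule0.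
  by rewrite -!EFinB -EFinM; congr EFin; field; rewrite gt_eqF.
rewrite imE (lebesgue_measure_unique H mA) /mu /mscale/= /pushforward/=.
by rewrite muleA -EFinM divff ?gt_eqF// mul1e.
Qed.

Lemma measurable_affine_image (a c : R) (A : set R) : 0 < a -> measurable A ->
  measurable [set a * x + c | x in A].
Proof.
move=> a0 mA; rewrite (_ : [set _ | _ in _] = (fun y => a^-1 * y + - (a^-1 * c)) @^-1` A).
  by rewrite -[X in measurable X]setTI; apply: measurable_affine.
apply/seteqP; split => [_ [x Ax <-]|y Ay] /=.
  by rewrite mulrDr mulrA mulVf ?gt_eqF// mul1r addrK.
by exists (a^-1 * y + - (a^-1 * c)) => //; rewrite mulrDr mulrN !mulrA divff ?gt_eqF//; ring.
Qed.

End affine_lebesgue.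

Section brunn_minkowski_R.
Context {R : realType}.
Local Notation leb := (@lebesgue_measure R).
Variables (al be : R).
Hypotheses (al0 : 0 < al) (be0 : 0 < be).

(** Take a in A near sup A and b in B near inf B. The translates al A + be b and be B + al a both
    lie in C; the first ends by q, the second starts from p, and q - p <= e. So they are disjoint up
    to a piece of length e. *)
Let brunn_minkowski_bounded (A B C : set R) :
  measurable A -> measurable B -> measurable C ->
  has_sup A -> has_inf B ->
  (forall x y, A x -> B y -> C (al * x + be * y)) ->
  (al%:E * leb A + be%:E * leb B <= leb C)%E.
Proof.
move=> mA mB mC sA iB ABC; apply/lee_addgt0Pr => e e0.
have ab0 : 0 < al + be by rewrite addr_gt0.
set d := e / (al + be).
have d0 : 0 < d by rewrite divr_gt0.
have [a Aa a_lt] := sup_adherent d0 sA.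
have [b Bb b_lt] := inf_adherent d0 iB.
pose p := al * a + be * inf B; pose q := al * sup A + be * b.
pose A1 := [set al * x + be * b | x in A].
pose B1 := [set be * y + al * a | y in B].
have mA1 : measurable A1 by exact: measurable_affine_image.
have mB1 : measurable B1 by exact: measurable_affine_image.
have mp : measurable `]-oo, p[%classic by exact: measurable_itv.
have A1q x : A1 x -> x <= q.
  by move=> [y Ay <-]; rewrite lerD2r ler_pM2l//; apply: ub_le_sup => //; case: sA.
have B1p x : B1 x -> p <= x.
  move=> [y By <-]; rewrite /p addrC lerD2r ler_pM2l//.
  by apply: ge_inf => //; case: iB.
have dis : (A1 `&` `]-oo, p[) `&` B1 = set0.
  rewrite -subset0 => x [[_ /=]]; rewrite in_itv/= => xp /B1p px.
  by move: (lt_le_trans xp px); rewrite ltxx.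
have qp : q - p <= e.
  have -> : e = al * d + be * d by rewrite -mulrDl /d mulrC divfK// gt_eqF.
  have : al * (sup A - d) <= al * a by rewrite ler_pM2l// ltW.
  have : be * b <= be * (inf B + d) by rewrite ler_pM2l// ltW.
  by rewrite /q /p; lra.
have A1split : (leb A1 <= leb (A1 `&` `]-oo, p[) + e%:E)%E.
  have m1 : measurable (A1 `&` `]-oo, p[) by exact: measurableI.
  have m2 : measurable `[p, q]%classic by exact: measurable_itv.
  apply: (@le_trans _ _ (leb ((A1 `&` `]-oo, p[) `|` `[p, q]%classic))).
    apply: le_measure; rewrite ?inE//; first exact: measurableU.
    move=> x A1x; have [xp|px] := ltP x p; [left|right].
      by split => //=; rewrite in_itv.
    by rewrite /= in_itv/= px A1q.
  apply: (le_trans (measureU2 _ _ _)) => //.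
  rewrite leeD2l//; rewrite [leLHS]lebesgue_measure_itv/= lte_fin; case: ifPn => _.
    by rewrite -EFinB lee_fin.
  by rewrite lee_fin ltW.
rewrite -(lebesgue_measure_affine (be * b) al0 mA).
rewrite -(lebesgue_measure_affine (al * a) be0 mB) -/A1 -/B1.
apply: (le_trans (leeD2r _ A1split)); rewrite addeAC leeD2r//.
rewrite -measureU//; last by apply: measurableI.
apply: le_measure; rewrite ?inE//; first by apply: measurableU => //; exact: measurableI.
move=> x [[[y Ay <-] _]|[y By <-]]; first exact: ABC.
by rewrite addrC; apply: ABC.
Qed.

(** The bounded case is applied to the truncations to [-n, n], whose measures increase to those of A
    and B. The limit starts from an n for which the truncations contain a and b. *)
Lemma brunn_minkowski_R (A B C : set R) :
  measurable A -> measurable B -> measurable C -> A !=set0 -> B !=set0 ->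
  (forall x y, A x -> B y -> C (al * x + be * y)) ->
  (al%:E * leb A + be%:E * leb B <= leb C)%E.
Proof.
move=> mA mB mC [a Aa] [b Bb] ABC.
pose T (X : set R) (n : nat) := X `&` [set x | `|x| <= n%:R].
have mT X n : measurable X -> measurable (T X n).
  move=> mX; apply: measurableI => //.
  rewrite (_ : [set x | _] = `[- n%:R, n%:R]%classic); first exact: measurable_itv.
  by apply/seteqP; split => x /=; rewrite in_itv/= ler_norml.
have cvgT X : measurable X -> leb (T X n) @[n --> \oo] --> leb X.
  move=> mX; have XE : X = \bigcup_n T X n.
    apply/seteqP; split => [x Xx|x [n _ []]//].
    exists (Num.truncn `|x|).+1 => //; split => //=.
    by rewrite ltW// truncnS_gt.
  rewrite [in X in _ --> X]XE; apply: nondecreasing_cvg_mu.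
  - by move=> n; exact: mT.
  - by rewrite -XE.
  - move=> m n mn; apply/subsetPset => x [Xx /= xm]; split => //=.
    by rewrite (le_trans xm)// ler_nat.
have bT X n : (T X n !=set0 -> has_sup (T X n) /\ has_inf (T X n)).
  move=> X0; split; split => //.
    by exists n%:R => x [_ /=]; rewrite ler_norml => /andP[].
  by exists (- n%:R) => x [_ /=]; rewrite ler_norml => /andP[].
have cvgL : (al%:E * leb (T A n) + be%:E * leb (T B n))%E @[n --> \oo] -->
     (al%:E * leb A + be%:E * leb B)%E.
  apply: cvgeD; last 2 first.
  - by apply: cvgeZl => //; exact: cvgT.
  - by apply: cvgeZl => //; exact: cvgT.
  by rewrite ge0_adde_def// inE mule_ge0// lee_fin ltW.
rewrite -(cvg_lim _ cvgL)//; apply: lime_le; first by apply/cvg_ex; eexists; exact: cvgL.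
exists (maxn (Num.truncn `|a|).+1 (Num.truncn `|b|).+1) => // n /= /[!geq_max] /andP[an bn].
have Ta : T A n a.
  by split => //=; rewrite ltW// (lt_le_trans (truncnS_gt _))// ler_nat.
have Tb : T B n b.
  by split => //=; rewrite ltW// (lt_le_trans (truncnS_gt _))// ler_nat.
apply: brunn_minkowski_bounded => //; try exact: mT.
- by have [] := bT A n (ex_intro _ _ Ta).
- by have [] := bT B n (ex_intro _ _ Tb).
- by move=> x y [Ax _] [By _]; exact: ABC.
Qed.

End brunn_minkowski_R.

(** Tonelli's theorem for the region 0 < t < f x: its sections at fixed x are intervals of length f
    x, possibly infinite, and its sections at fixed t are the level sets. *)
Lemma layer_cake (R : realType) d (T : measurableType d)
    (mu : {sigma_finite_measure set T -> \bar R}) (f : T -> \bar R) :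
  measurable_fun setT f -> (forall x, 0 <= f x)%E ->
  (\int[mu]_x f x = \int[@lebesgue_measure R]_t mu [set x | (0 < t)%R /\ (t%:E < f x)%E])%E.
Proof.
move=> mf f0.
pose A : set (T * measurableTypeR R) := [set p | 0 < p.2 /\ ((p.2)%:E < f p.1)%E].
have mA : measurable A.
  have m0 : measurable_fun [set: T * measurableTypeR R] (fun p => p.2 : R).
    exact: measurable_snd.
  rewrite (_ : A = (setT `&` [set p | (0 < (p.2)%:E)%E]) `&`
     (setT `&` [set p | ((p.2)%:E < f p.1)%E])); last first.
    by rewrite !setTI; apply/seteqP; split => p [/=]; rewrite lte_fin.
  apply: measurableI; apply: measurable_lte => //.
  - by apply/measurable_EFinP.
  - by apply/measurable_EFinP.
  - exact: measurableT_comp.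
have := indic_fubini_tonelli mu (@lebesgue_measure R) mA.
rewrite indic_fubini_tonelli_FE// indic_fubini_tonelli_GE// => FG.
transitivity (\int[mu]_x (lebesgue_measure \o xsection A) x)%E.
  apply: eq_integral => x _ /=.
  have -> : xsection A x = [set t | 0 < t /\ (t%:E < f x)%E].
    by apply/seteqP; split => t; rewrite /xsection/= inE.
  have := f0 x; case: (f x) => [r|_|//].
    rewrite lee_fin => r0.
    rewrite (_ : [set _ | _] = `]0, r[%classic); last first.
      by apply/seteqP; split => t /=; rewrite in_itv/= lte_fin => /andP.
    rewrite lebesgue_measure_itv/= lte_fin; case: ltP => [_|r0']; first by rewrite sube0.
    by have -> : r = 0 by apply/eqP; rewrite eq_le r0 r0'.
  rewrite (_ : [set _ | _] = `]0, +oo[%classic); last first.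
    apply/seteqP; split => t /=; rewrite in_itv/= andbT; first by case.
    by move=> t0; split => //; rewrite ltry.
  by rewrite lebesgue_measure_itv/= ltry.
rewrite FG; apply: eq_integral => t _ /=; congr (mu _).
by apply/seteqP; split => x; rewrite /ysection/= inE.
Qed.

(* For k > 0 and f, g > 0 this says that h (op x y) is at least the weighted mean
   (al * f x ^ (-1/k) + be * g y ^ (-1/k)) ^ (-k). The free parameter c changes
   nothing when k > 0, but makes the case k = 0 read min (f x) (g y) <= h (op x y). *)
Definition bbl_rel (R : realType) (al be : R) (k : nat) (T : Type)
    (op : T -> T -> T) (f g h : T -> \bar R) :=
  forall x y c A B, 0 < c -> 0 < A -> 0 < B ->
  ((c / A ^+ k)%:E < f x)%E -> ((c / B ^+ k)%:E < g y)%E ->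
  ((c / (al * A + be * B) ^+ k)%:E <= h (op x y))%E.

Section bbl_R.
Context {R : realType}.
Local Notation leb := (@lebesgue_measure R).
Variables (al be : R).
Hypotheses (al0 : 0 < al) (be0 : 0 < be).
Implicit Types f g h : R -> \bar R.

(** For 0 < t < 1 the level sets of f and g are non-empty, and their combination lies in that of h.
    The one-dimensional Brunn-Minkowski inequality compares their measures, and the layer-cake
    formula integrates this over t. *)
Let bbl_normalized f g h :
  measurable_fun setT f -> measurable_fun setT g -> measurable_fun setT h ->
  (forall x, 0 <= f x <= 1)%E -> (forall x, 0 <= g x <= 1)%E ->
  (forall x, 0 <= h x)%E ->
  (forall t, 0 < t < 1 -> exists x, (t%:E < f x)%E) ->
  (forall t, 0 < t < 1 -> exists x, (t%:E < g x)%E) ->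
  (forall t x y, 0 < t < 1 -> (t%:E < f x)%E -> (t%:E < g y)%E ->
     (t%:E <= h (al * x + be * y)%R)%E) ->
  (al%:E * (\int[leb]_x f x) + be%:E * (\int[leb]_x g x) <= \int[leb]_x h x)%E.
Proof.
move=> mf mg mh f01 g01 h0 fne gne H.
have f0 x : (0 <= f x)%E by case/andP: (f01 x).
have g0 x : (0 <= g x)%E by case/andP: (g01 x).
pose L (u : R -> \bar R) (t : R) : set R := [set x | 0 < t /\ (t%:E < u x)%E].
have mL u t : measurable_fun setT u -> measurable (L u t).
  move=> mu; have [t0|t0] := ltP 0 t; last first.
    by rewrite (_ : L u t = set0)// -subset0 => x [/lt_le_trans/(_ t0)]; rewrite ltxx.
  rewrite (_ : L u t = setT `&` [set x | (t%:E < u x)%E]).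
    by apply: measurable_lte => //; exact: measurable_cst.
  by apply/seteqP; split => x; rewrite /L/=; tauto.
have mleb u : measurable_fun setT u -> measurable_fun setT (fun t => leb (L u t)).
  move=> mu.
  pose A : set (measurableTypeR R * measurableTypeR R) :=
    [set p | 0 < p.1 /\ ((p.1)%:E < u p.2)%E].
  have mA : measurable A.
    have m0 : measurable_fun [set: measurableTypeR R * measurableTypeR R] (fun p => p.1 : R).
      exact: measurable_fst.
    rewrite (_ : A = (setT `&` [set p | (0 < (p.1)%:E)%E]) `&`
       (setT `&` [set p | ((p.1)%:E < u p.2)%E])); last first.
      by rewrite !setTI; apply/seteqP; split => p [/=]; rewrite lte_fin.
    apply: measurableI; apply: measurable_lte => //.
    - by apply/measurable_EFinP.
    - by apply/measurable_EFinP.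
    - by apply: measurableT_comp.
  rewrite (_ : (fun t => _) = leb \o xsection A); first exact: measurable_fun_xsection.
  apply/funext => t /=; congr (leb _).
  by apply/seteqP; split => x; rewrite /xsection/= inE.
rewrite (layer_cake leb mf f0) (layer_cake leb mg g0) (layer_cake leb mh h0).
rewrite -(ge0_integralZl leb measurableT (mleb f mf))//; last by rewrite lee_fin ltW.
rewrite -(ge0_integralZl leb measurableT (mleb g mg))//; last by rewrite lee_fin ltW.
rewrite -ge0_integralD//; last 4 first.
- by move=> t _; rewrite mule_ge0// lee_fin ltW.
- by apply: measurable_funeM; exact: mleb.
- by move=> t _; rewrite mule_ge0// lee_fin ltW.
- by apply: measurable_funeM; exact: mleb.
apply: ge0_le_integral => //.
- by move=> t _; rewrite adde_ge0// mule_ge0// lee_fin ltW.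
- by apply: emeasurable_funD; apply: measurable_funeM; exact: mleb.
- exact: mleb.
move=> t _; rewrite -/(L f t) -/(L g t) -/(L h t).
have [t1|t1] := ltP t 1; last first.
  suff Lempty u : (forall x, 0 <= u x <= 1)%E -> L u t = set0.
    rewrite (Lempty f)// (Lempty g)// measure0 !mule0 adde0.
    exact: measure_ge0.
  move=> u01; rewrite -subset0 => x [_ /lt_le_trans].
  by move=> /(_ 1%E); case/andP: (u01 x) => _ -> /(_ isT); rewrite lte_fin ltNge t1.
have [t0|t0] := ltP 0 t; last first.
  suff Lempty u : L u t = set0.
    rewrite !Lempty measure0 !mule0 adde0.
    exact: measure_ge0.
  by rewrite -subset0 => x [/lt_le_trans/(_ t0)]; rewrite ltxx.
have t01 : 0 < t < 1 by rewrite t0 t1.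
apply: brunn_minkowski_R => //; try exact: mL.
- by case: (fne t t01) => x ftx; exists x.
- by case: (gne t t01) => x ftx; exists x.
move=> x y [_ fx] [_ gy]; split => //.
(* The hypothesis yields only a weak lower bound on h, whereas the level set is strict; a slightly
   higher level s restores strictness. *)
have [s st [sx sy]] : exists2 s, t < s < 1 & (s%:E < f x)%E /\ (s%:E < g y)%E.
  have [s ts1] : exists s, t < s /\ (s%:E < Order.min 1%:E (Order.min (f x) (g y)))%E.
    have : (t%:E < Order.min 1%:E (Order.min (f x) (g y)))%E.
      by rewrite !lt_min lte_fin t1 fx gy.
    case: (Order.min _ _) => [r||//]; last by exists (t + 1); rewrite ltrDl ltr01 ltry.
    rewrite lte_fin => tr; exists ((t + r) / 2); rewrite lte_fin.
    by rewrite midf_lt//; lra.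
  by move: ts1; rewrite !lt_min lte_fin => -[ts /and3P[s1 fs gs]]; exists s => //; rewrite ts s1.
apply: (@lt_le_trans _ _ s%:E); first by rewrite lte_fin; case/andP: st.
by apply: H => //; case/andP: st => ts ->; rewrite (lt_trans t0).
Qed.

Let root_exists k (a : R) : 0 < a -> exists2 u, 0 < u & a = (u ^+ k.+1)^-1.
Proof.
move=> a0; exists (a `^ (- (k.+1%:R)^-1)); first exact: powR_gt0.
rewrite -powR_mulrn ?powR_ge0// -powRrM mulNr mulVf ?pnatr_eq0//.
by rewrite powRN powRr1 ?(ltW a0)// invrK.
Qed.

Let bounded_sup f (N : R) : (forall x, 0 <= f x)%E -> (forall x, f x <= N%:E)%E ->
  (0 < \int[leb]_x f x)%E -> exists a, [/\ 0 < a, (forall x, f x <= a%:E)%E &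
   forall e, e < a -> exists x, (e%:E < f x)%E].
Proof.
move=> f0 fN If.
pose s := ereal_sup (range f).
have fs x : (f x <= s)%E by apply: ereal_sup_ubound; exists x.
have s_gt0 : (0 < s)%E.
  rewrite ltNge; apply/negP => s0; move: If.
  rewrite integral0_eq ?ltxx// => x _; apply/eqP.
  by rewrite eq_le f0 andbT (le_trans (fs x)).
have sN : (s <= N%:E)%E by apply: ge_ereal_sup => _ [x _ <-].
have sfin : s \is a fin_num by rewrite ge0_fin_numE ?(ltW s_gt0)// (le_lt_trans sN)// ltry.
exists (fine s); split; rewrite ?fineK//.
  by rewrite -lte_fin fineK.
move=> e; rewrite -lte_fin fineK// => /ereal_sup_gt[_ [x _ <-] ex].
by exists x.
Qed.

(* Write sup f = u^-(k+1) and sup g = v^-(k+1); dividing f, g, h by sup f, sup g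
   and (al * u + be * v)^-(k+1) reduces to functions of supremum 1, whose level
   sets at equal heights satisfy Brunn-Minkowski. *)
Let bbl_bounded k f g h (N : R) :
  measurable_fun setT f -> measurable_fun setT g -> measurable_fun setT h ->
  (forall x, 0 <= f x <= N%:E)%E -> (forall x, 0 <= g x <= N%:E)%E ->
  (forall x, 0 <= h x)%E ->
  bbl_rel al be k.+1 (fun x y => al * x + be * y) f g h ->
  forall c A B, 0 < c -> 0 < A -> 0 < B ->
  ((c / A ^+ k)%:E < \int[leb]_x f x)%E -> ((c / B ^+ k)%:E < \int[leb]_x g x)%E ->
  ((c / (al * A + be * B) ^+ k)%:E <= \int[leb]_x h x)%E.
Proof.
move=> mf mg mh fN gN h0 fgh c A B c0 A0 B0 cA cB.
have f0 x : (0 <= f x)%E by case/andP: (fN x).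
have g0 x : (0 <= g x)%E by case/andP: (gN x).
have [||a [a0 fa aP]] := @bounded_sup f N f0 => //.
- by move=> x; case/andP: (fN x).
- by apply: lt_trans cA; rewrite lte_fin divr_gt0// exprn_gt0.
have [||b [b0 gb bP]] := @bounded_sup g N g0 => //.
- by move=> x; case/andP: (gN x).
- by apply: lt_trans cB; rewrite lte_fin divr_gt0// exprn_gt0.
have [u u0 au] := root_exists k a0; have [v v0 bv] := root_exists k b0.
have uk0 : 0 < u ^+ k.+1 by rewrite exprn_gt0.
have vk0 : 0 < v ^+ k.+1 by rewrite exprn_gt0.
have w0 : 0 < al * u + be * v by rewrite addr_gt0// mulr_gt0.
have wk0 : 0 < (al * u + be * v) ^+ k.+1 by rewrite exprn_gt0.
have S0 : 0 < al * A + be * B by rewrite addr_gt0// mulr_gt0.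
set W := (al * u + be * v) ^+ k.+1 in wk0 *.
have scale01 (F : R -> \bar R) (z r : R) : 0 < z -> r = z^-1 ->
   (forall x, 0 <= F x)%E -> (forall x, F x <= r%:E)%E -> forall x, (0 <= z%:E * F x <= 1)%E.
  move=> z0 rz F0 Fr x; rewrite mule_ge0 ?lee_fin ?(ltW z0)//=.
  apply: (@le_trans _ _ (z%:E * r%:E)%E); first by rewrite lee_wpmul2l// lee_fin ltW.
  by rewrite -EFinM rz divff// gt_eqF.
have scale_lt (z t : R) (X : \bar R) : 0 < z -> (t%:E < z%:E * X)%E = ((t / z)%:E < X)%E.
  by move=> z0; rewrite EFinM lte_pdivrMr// muleC.
have scale_ne (F : R -> \bar R) (z r : R) : 0 < z -> r = z^-1 ->
   (forall e, e < r -> exists x, (e%:E < F x)%E) ->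
   forall t, 0 < t < 1 -> exists x, (t%:E < z%:E * F x)%E.
  move=> z0 rz rP t /andP[_ t1]; have [|x Hx] := rP (t / z); last by exists x; rewrite scale_lt.
  by rewrite rz ltr_pdivrMr// mulVf ?gt_eqF.
have := @bbl_normalized (fun x => (u ^+ k.+1)%:E * f x)%E (fun x => (v ^+ k.+1)%:E * g x)%E
  (fun x => W%:E * h x)%E.
rewrite !ge0_integralZl//; try by rewrite lee_fin ltW.
move=> H; have {H} :
  (al%:E * ((u ^+ k.+1)%:E * \int[leb]_x f x) +
   be%:E * ((v ^+ k.+1)%:E * \int[leb]_x g x) <= W%:E * \int[leb]_x h x)%E.
  apply: H; try exact: measurable_funeM.
  - exact: (scale01 _ _ a).
  - exact: (scale01 _ _ b).
  - by move=> x; rewrite mule_ge0// lee_fin ltW.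
  - exact: (scale_ne _ _ a).
  - exact: (scale_ne _ _ b).
  - move=> t x y /andP[t0 t1]; rewrite !scale_lt// => tf tg.
    have := fgh x y t u v t0 u0 v0 tf tg; rewrite -/W.
    by rewrite EFinM lee_pdivrMr// muleC.
move=> H.
(* The bounds on the integrals of f and g make the left side of [H] at least c (al u^(k+1) / A^k +
   be v^(k+1) / B^k). Convexity of the perspective bounds this below by c W / (al A + be B)^k. *)
have K : (W%:E * (c / (al * A + be * B) ^+ k)%:E <= W%:E * \int[leb]_x h x)%E.
  apply: le_trans H.
  apply: (@le_trans _ _ (al%:E * ((u ^+ k.+1)%:E * (c / A ^+ k)%:E) +
     be%:E * ((v ^+ k.+1)%:E * (c / B ^+ k)%:E))%E); last first.
    by apply: leeD; rewrite !lee_pmul2l ?lte_fin// ltW.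
  rewrite -!EFinM -EFinD lee_fin.
  have := perspective_convex k al0 be0 (ltW u0) (ltW v0) A0 B0.
  rewrite -/W -(ler_pM2l c0) => /le_trans-/(_ _) P.
  rewrite mulrCA; apply: P; rewrite mulrDr le_eqVlt; apply/orP; left; apply/eqP.
  by ring.
by move: K; rewrite lee_pmul2l// lte_fin.
Qed.

(** Truncating f and g at height n only lowers them, so the relation to h survives; by monotone
    convergence the two strict bounds survive for large n. This reduces to bounded f and g. *)
Lemma bbl_R k f g h :
  measurable_fun setT f -> measurable_fun setT g -> measurable_fun setT h ->
  (forall x, 0 <= f x)%E -> (forall x, 0 <= g x)%E -> (forall x, 0 <= h x)%E ->
  bbl_rel al be k.+1 (fun x y => al * x + be * y) f g h ->
  forall c A B, 0 < c -> 0 < A -> 0 < B ->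
  ((c / A ^+ k)%:E < \int[leb]_x f x)%E -> ((c / B ^+ k)%:E < \int[leb]_x g x)%E ->
  ((c / (al * A + be * B) ^+ k)%:E <= \int[leb]_x h x)%E.
Proof.
move=> mf mg mh f0 g0 h0 fgh c A B c0 A0 B0 cA cB.
pose trunc (F : R -> \bar R) (n : nat) x := Order.min (F x) n%:R%:E.
have mtrunc F n : measurable_fun setT F -> measurable_fun setT (trunc F n).
  by move=> mF; apply: measurable_mine => //; exact: measurable_cst.
have trunc0 F n : (forall x, 0 <= F x)%E -> forall x, (0 <= trunc F n x <= n%:R%:E)%E.
  by move=> F0 x; rewrite /trunc le_min F0 lee_fin ler0n ge_min lexx orbT.
have trunc_nd F x : nondecreasing_seq (trunc F ^~ x).
  by move=> m n mn; rewrite /trunc le_min !ge_min lexx/= lee_fin ler_nat mn orbT.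
have trunc_cvg F x : (0 <= F x)%E -> trunc F n x @[n --> \oo] --> F x.
  move=> F0; have := ereal_nondecreasing_cvgn (trunc_nd F x).
  suff -> : ereal_sup (range (trunc F ^~ x)) = F x by [].
  apply/eqP; rewrite eq_le; apply/andP; split.
    by apply: ge_ereal_sup => _ [n _ <-]; rewrite /trunc ge_min lexx.
  case Fx : (F x) F0 => [r| |//] F0.
    apply: ereal_sup_ubound; exists (Num.truncn r).+1 => //.
    by rewrite /trunc Fx; apply/min_idPl; rewrite lee_fin ltW// truncnS_gt.
  rewrite leye_eq; apply/eqP/eq_infty => r.
  apply: ereal_sup_ge; exists (Num.truncn `|r|).+1%:R%:E.
    by exists (Num.truncn `|r|).+1 => //; rewrite /trunc Fx; apply/min_idPr; rewrite leey.
  by rewrite lee_fin (le_trans (ler_norm r))// ltW// truncnS_gt.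
have key F (z : R) : measurable_fun setT F -> (forall x, 0 <= F x)%E ->
    (z%:E < \int[leb]_x F x)%E -> \forall n \near \oo, (z%:E < \int[leb]_x trunc F n x)%E.
  move=> mF F0 zF.
  have : (\int[leb]_x trunc F n x)%E @[n --> \oo] --> (\int[leb]_x F x)%E.
    rewrite (_ : (\int[leb]_x F x)%E = \int[leb]_x (limn (trunc F ^~ x)))%E; last first.
      by apply: eq_integral => x _; apply/esym/cvg_lim => //; exact: trunc_cvg.
    have trunc_ge0 n x : setT x -> (0 <= trunc F n x)%E.
      by move=> _; case/andP: (trunc0 F n F0 x).
    exact: (@cvg_monotone_convergence _ _ _ leb setT measurableT (trunc F)
      (fun n => mtrunc F n mF) trunc_ge0 (fun x _ => trunc_nd F x)).
  move=> /(_ [set y | (z%:E < y)%E]); apply.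
  by apply: open_nbhs_nbhs; split => //; exact: open_ereal_gt_ereal.
have [n _ /(_ _ (leqnn n))/= [fn gn]] := filterI (key f _ mf f0 cA) (key g _ mg g0 cB).
apply: (@bbl_bounded k (trunc f n) (trunc g n) h n%:R) => //; try exact: mtrunc; try exact: trunc0.
move=> x y c' A' B' c'0 A'0 B'0 fx gy; apply: fgh => //.
  by move: fx; rewrite /trunc lt_min => /andP[].
by move: gy; rewrite /trunc lt_min => /andP[].
Qed.

End bbl_R.

(** * Integration on R^n *)

Section integral_rV.
Context {R : realType}.
Local Notation leb := (@lebesgue_measure R).
Local Notation borel := (@borel_lebesgue_rV R).

Lemma ge0_integral_rVS n (f : 'rV[R]_n.+1 -> \bar R) :
  measurable_fun setT f -> (forall x, 0 <= f x)%E ->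
  (\int[borel n.+1]_x f x = \int[leb]_s \int[borel n]_y f (rV_cons (s, y)))%E.
Proof.
move=> mf f0.
transitivity (\int[leb \x borel n]_p (f \o (@rV_cons R n)) p)%E.
  have mcons : measurable_fun [set: measurableTypeR R * 'rV[R]_n] (@rV_cons R n).
    exact: measurable_rV_cons.
  exact: (@ge0_integral_pushforward _ _ _ _ _ _ mcons
    (leb \x borel n)%E setT f measurableT mf (fun x _ => f0 x)).
rewrite fubini_tonelli1//; last by move=> p /=.
by apply: measurableT_comp => //; exact: measurable_rV_cons.
Qed.

Lemma measurable_fun_rV_slice n (f : 'rV[R]_n.+1 -> \bar R) s :
  measurable_fun setT f -> measurable_fun setT (fun y => f (rV_cons (s, y))).
Proof.
move=> mf; apply: (measurableT_comp mf).
by apply: (measurableT_comp (@measurable_rV_cons R n)); exact: measurable_pair1.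
Qed.

Lemma measurable_fun_rV_integral n (f : 'rV[R]_n.+1 -> \bar R) :
  measurable_fun setT f -> (forall x, 0 <= f x)%E ->
  measurable_fun setT (fun s : R => \int[borel n]_y f (rV_cons (s, y)))%E.
Proof.
move=> mf f0.
apply: (@measurable_fun_fubini_tonelli_F _ _ _ _ _ (borel n) (f \o (@rV_cons R n))).
- by apply: measurableT_comp => //; exact: measurable_rV_cons.
- by move=> p; exact: f0.
Qed.

Lemma rV_consD n (al be s t : R) (x y : 'rV[R]_n) :
  rV_cons (al * s + be * t, al *: x + be *: y) =
  al *: rV_cons (s, x) + be *: rV_cons (t, y).
Proof. by apply/rowP => i; rewrite !mxE; case: unliftP => [j|] _ /=; rewrite ?mxE. Qed.

(** Induction on the dimension. The induction hypothesis with k+1 on the slices shows that the slice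
    integrals satisfy the relation of index k+1, and [bbl_R] lowers it to k. In dimension 0 the
    measure is a Dirac mass and the relation itself is the conclusion. *)
Lemma bbl_rV (al be : R) (m k : nat) (f g h : 'rV[R]_m -> \bar R) :
  0 < al -> 0 < be ->
  measurable_fun setT f -> measurable_fun setT g -> measurable_fun setT h ->
  (forall x, 0 <= f x)%E -> (forall x, 0 <= g x)%E -> (forall x, 0 <= h x)%E ->
  bbl_rel al be (m + k) (fun x y => al *: x + be *: y) f g h ->
  forall c A B, 0 < c -> 0 < A -> 0 < B ->
  ((c / A ^+ k)%:E < \int[borel m]_x f x)%E ->
  ((c / B ^+ k)%:E < \int[borel m]_x g x)%E ->
  ((c / (al * A + be * B) ^+ k)%:E <= \int[borel m]_x h x)%E.
Proof.
move=> al0 be0; elim: m k f g h => [|m IH] k f g h mf mg mh f0 g0 h0 fgh c A B c0 A0 B0.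
  rewrite !integral_dirac// !diracT !mul1e => fA gB.
  by have := fgh _ _ _ _ _ c0 A0 B0 fA gB; rewrite !scaler0 addr0.
rewrite !ge0_integral_rVS// => fA gB.
apply: (@bbl_R _ _ _ al0 be0 k (fun s => \int[borel m]_y f (rV_cons (s, y)))%E
  (fun s => \int[borel m]_y g (rV_cons (s, y)))%E
  (fun s => \int[borel m]_y h (rV_cons (s, y)))%E
  _ _ _ _ _ _ _ c A B c0 A0 B0 fA gB).
- exact: measurable_fun_rV_integral.
- exact: measurable_fun_rV_integral.
- exact: measurable_fun_rV_integral.
- by move=> s; exact: integral_ge0.
- by move=> s; exact: integral_ge0.
- by move=> s; exact: integral_ge0.
move=> s t d C D d0 C0 D0 fC gD.
apply: (IH k.+1 _ _ _ _ _ _ _ _ _ _ _ _ _ d0 C0 D0 fC gD) => //.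
- exact: measurable_fun_rV_slice.
- exact: measurable_fun_rV_slice.
- exact: measurable_fun_rV_slice.
by rewrite -addSnnS => x y d' E F d'0 E0 F0 fE gF; rewrite rV_consD; apply: fgh.
Qed.

End integral_rV.

(** * Borel sets and Lebesgue measure on R^n *)

Section lebesgue_rV.
Context {R : realType}.
Local Notation borel := (@borel_lebesgue_rV R).

Lemma rV_ballP n (x y : 'rV[R]_n) (e : R) : 0 < e ->
  ball x e y <-> forall i, `|x ord0 i - y ord0 i| < e.
Proof.
move=> e0; split => [[_ xy] i|xy]; first exact: xy.
by split => // i j; rewrite ord1; exact: xy.
Qed.

(** U is the union of the boxes with rational centre and radius 1/(k+1) that it contains, which are
    countably many. A radius below e/2 leaves room for the box to contain x and stay in the ball of
    radius e around x. *)
Lemma open_measurable_rV n (U : set 'rV[R]_n) : open U -> measurable U.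
Proof.
move=> oU.
pose box (p : 'rV[rat]_n * nat) : set 'rV[R]_n :=
  [set y | forall i, `|ratr (p.1 ord0 i) - y ord0 i| < (p.2.+1%:R)^-1].
have mbox p : measurable (box p).
  rewrite (_ : box p = \bigcap_(i in [set: 'I_n])
    ((fun y : 'rV[R]_n => y ord0 i) @^-1` (ball (ratr (p.1 ord0 i) : R) (p.2.+1%:R)^-1))).
    apply: fin_bigcap_measurable => // i _; rewrite -[X in measurable X]setTI.
    by apply: measurable_rV_coord => //; exact: measurable_ball.
  by apply/seteqP; split => y /= H i; [move=> _; exact: H|exact: H].
pose F p := if `[< box p `<=` U >] then box p else set0.
rewrite (_ : U = \bigcup_p F p).
  apply: countable_bigcupT_measurable => //.
  by move=> p; rewrite /F; case: ifPn => // _; exact: measurable0.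
apply/seteqP; split => [x Ux|x [p _]]; last first.
  by rewrite /F; case: ifPn => [/asboolP + ?|//]; apply.
have /nbhs_ballP[e /= e0 xeU] : nbhs x U by exact: open_nbhs_nbhs.
have [k ke] : exists k : nat, (k.+1%:R)^-1 < e / 2.
  exists (Num.truncn (e / 2)^-1); rewrite invf_plt ?posrE ?divr_gt0//.
  by rewrite truncnS_gt.
have kgt0 : 0 < (k.+1%:R)^-1 :> R by rewrite invr_gt0.
have q_ i : {q : rat | `|ratr q - x ord0 i| < (k.+1%:R)^-1}.
  apply: cid.
  have [|q] := @rat_in_itvoo R (x ord0 i - (k.+1%:R)^-1) (x ord0 i + (k.+1%:R)^-1).
    by rewrite ltrD2l gtrN.
  by rewrite in_itv/= => /andP[h1 h2]; exists q; rewrite ltr_distl h1 h2.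
pose q : 'rV[rat]_n := \row_i sval (q_ i).
exists (q, k) => //; rewrite /F ifT.
  by move=> i /=; rewrite mxE; case: (q_ i).
apply/asboolP => y yq; apply: xeU; apply/rV_ballP => // i.
have := yq i; rewrite /= mxE; case: (q_ i) => r /= rx ry.
have -> : x ord0 i - y ord0 i = (x ord0 i - ratr r) + (ratr r - y ord0 i) by ring.
by rewrite (le_lt_trans (ler_normD _ _))// [ltRHS]splitr ltrD ?(lt_trans _ ke)// distrC.
Qed.

Lemma closed_measurable_rV n (U : set 'rV[R]_n) : closed U -> measurable U.
Proof.
move=> cU; rewrite -(setCK U); apply: measurableC; apply: open_measurable_rV.
exact: closed_openC.
Qed.

Lemma measurable_rV_box n (a b : 'I_n -> R) :
  measurable [set x : 'rV[R]_n | forall i, a i <= x ord0 i < b i].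
Proof.
rewrite (_ : [set x | _] = \bigcap_(i in [set: 'I_n])
    ((fun y : 'rV[R]_n => y ord0 i) @^-1` `[a i, b i[)).
  apply: fin_bigcap_measurable => // i _; rewrite -[X in measurable X]setTI.
  by apply: measurable_rV_coord => //; exact: measurable_itv.
by apply/seteqP; split => y /= H i; [move=> _|]; have := H i; rewrite /= in_itv/= => H'; [|exact: H'].
Qed.

Lemma borel_lebesgue_box n (a b : 'I_n -> R) : (forall i, a i <= b i) ->
  borel n [set x | forall i, a i <= x ord0 i < b i] = (\prod_i (b i - a i))%:E.
Proof.
elim: n a b => [|n IH] a b ab.
  rewrite big_ord0 (_ : mkset _ = setT); first exact: diracT.
  by apply/seteqP; split => // x _ [].
rewrite big_ord_recl EFinM -IH//.
rewrite -[LHS]/(rV_prod (borel n) _) /rV_prod /pushforward.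
rewrite (_ : _ @^-1` _ = `[a ord0, b ord0[ `*`
  [set y : 'rV_n | forall i, a (lift ord0 i) <= y ord0 i < b (lift ord0 i)]); last first.
  apply/seteqP; split => -[s y] /=.
    move=> H; split.
      by have := H ord0; rewrite mxE unlift_none in_itv.
    by move=> i; have := H (lift ord0 i); rewrite mxE liftK.
  rewrite in_itv => -[/= sab yab] i; rewrite mxE.
  by case: unliftP => [j|] -> /=.
rewrite product_measure1E//; last exact: measurable_rV_box.
congr (_ * _)%E; rewrite [LHS]lebesgue_measure_itv/= lte_fin.
have [ab0|ba] := ltP; first by rewrite EFinB.
by congr EFin; apply/esym/eqP; rewrite subr_eq0 eq_le ba ab.
Qed.

Lemma borel_lebesgue_bounded n (A : set 'rV[R]_n) (M : R) : measurable A ->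
  (forall x, A x -> forall i, `|x ord0 i| <= M) -> (borel n A < +oo)%E.
Proof.
(* The added 1 places A inside a box that is open on the right. *)
move=> mA AM; pose N := `|M| + 1.
have MN : M < N by rewrite (le_lt_trans (ler_norm _))// ltrDl.
have N0 : 0 <= N by rewrite addr_ge0.
apply: (@le_lt_trans _ _ (borel n [set x | forall i, - N <= x ord0 i < N])).
  apply: le_measure; rewrite ?inE//.
    exact: (measurable_rV_box (fun=> - N) (fun=> N)).
  move=> x Ax i; have := AM x Ax i; rewrite ler_norml => /andP[h1 h2].
  by rewrite (le_trans _ h1)/= ?(le_lt_trans h2)// lerNl opprK ltW.
by rewrite (@borel_lebesgue_box n (fun=> - N) (fun=> N)) ?ltry// => i; rewrite (le_trans _ N0)// oppr_le0.
Qed.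

Lemma borel_lebesgue_open_gt0 n (U : set 'rV[R]_n) : open U -> U !=set0 ->
  (0 < borel n U)%E.
Proof.
move=> oU [x Ux].
have /nbhs_ballP[e /= e0 xeU] : nbhs x U by exact: open_nbhs_nbhs.
apply: (@lt_le_trans _ _ (borel n [set y | forall i, x ord0 i <= y ord0 i < x ord0 i + e])).
  rewrite (@borel_lebesgue_box n (fun i => x ord0 i) (fun i => x ord0 i + e)).
    by rewrite lte_fin prodr_gt0// => i _; rewrite addrC addKr.
  by move=> i; rewrite lerDl ltW.
apply: le_measure; rewrite ?inE.
- exact: measurable_rV_box.
- exact: open_measurable_rV.
- move=> y yx; apply: xeU; apply/rV_ballP => // i.
  by case/andP: (yx i) => h1 h2; rewrite distrC ger0_norm ?subr_ge0// ltrBlDl.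
Qed.

Lemma lebesgue_rVE n (A : set 'rV[R]_n) : measurable A ->
  lebesgue_rV R n A = borel n A.
Proof. by move=> mA; rewrite /lebesgue_rV /completed_measure_extension measurable_mu_extE. Qed.

(** The identity from the Caratheodory sigma-algebra to the Borel one is measurable, and it pushes
    the completed measure forward to the Borel measure. *)
Lemma ge0_integral_lebesgue_rV n (f : 'rV[R]_n -> \bar R) :
  measurable_fun setT f -> (forall x, 0 <= f x)%E ->
  (\int[lebesgue_rV R n]_x f x = \int[borel n]_x f x)%E.
Proof.
move=> mf f0.
pose I : measurableType _ := caratheodory_type ((borel n)^*)%mu.
have mid : measurable_fun [set: I] (id : I -> 'rV[R]_n).
  by move=> _ Y mY; rewrite setTI; exact: caratheodory_measurable_mu_ext.
have := @ge0_integral_pushforward _ _ _ _ _ _ mid (lebesgue_rV R n) setT f measurableT mf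
  (fun x _ => f0 x).
rewrite preimage_setT => <-; apply/esym.
by apply: eq_measure_integral => A mA _ /=; rewrite /pushforward lebesgue_rVE.
Qed.

End lebesgue_rV.

(** The integral of a non-negative function is a supremum over the simple functions below it, so
    monotonicity asks for no measurability. This serves to squeeze the indicator of a convex set
    between those of its interior and closure. *)
Lemma ge0_le_integral_nonmeasurable d (T : measurableType d) (R : realType)
    (mu : {measure set T -> \bar R}) (f g : T -> \bar R) :
  (forall x, 0 <= f x)%E -> (forall x, f x <= g x)%E ->
  (\int[mu]_x f x <= \int[mu]_x g x)%E.
Proof.
move=> f0 fg; rewrite !ge0_integralTE//; last first.
  by move=> x; exact: le_trans (fg x).
apply: ge_ereal_sup => _ [h hf <-]; apply: ereal_sup_ubound; exists h => // x.
exact: le_trans (hf x) (fg x).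
Qed.

(** * Convex bodies and their boundary *)

Section convex_body.
Context {R : realType} {n : nat}.
Implicit Types (x y : 'rV[R]_n) (A : set 'rV[R]_n).
Local Notation borel := (@borel_lebesgue_rV R n).

Lemma convex_setP A : convex_set (A : set (convex_lmodType 'rV[R]_n)) ->
  forall x y l, 0 <= l <= 1 -> A x -> A y -> A ((1 - l) *: x + l *: y).
Proof.
move=> cA x y l /andP[l0 l1] Ax Ay.
have l01 : 0 <= 1 - l <= 1 by rewrite subr_ge0 l1 gerBl l0.
have := cA x y (Itv01 (proj1 (andP l01)) (proj2 (andP l01))).
rewrite !inE => /(_ Ax Ay); rewrite /conv/= /isConvexSpace.conv/= /unstable.onem.
by rewrite subKr.
Qed.

Lemma bounded_setP A : bounded_set A ->
  exists2 M, 0 < M & forall x, A x -> forall i, `|x ord0 i| <= M.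
Proof.
move=> [M [_ AM]]; exists (`|M| + 1); first by rewrite ltr_pwDr.
move=> x Ax i; apply: le_trans (AM (`|M| + 1) _ x Ax).
  rewrite [leRHS]mx_normrE.
  exact: (le_bigmax _ (fun ij => `|x ij.1 ij.2|) (ord0, i)).
by rewrite (le_lt_trans (ler_norm _))// ltrDl.
Qed.

Lemma segment_interior A x y l :
  convex_set (A : set (convex_lmodType 'rV[R]_n)) -> 0 < l <= 1 ->
  closure A x -> A° y -> A° ((1 - l) *: x + l *: y).
Proof.
move=> cA /andP[l0 l1] clx /nbhs_ballP[e /= e0 yeA].
apply/nbhs_ballP; exists (l * e / 2) => /=; first by rewrite divr_gt0 ?mulr_gt0.
set z := _ + _ => w zw.
have [x' [Ax' xx']] : A `&` ball x (l * e / 2) !=set0.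
  by apply: clx; apply: nbhsx_ballx; rewrite divr_gt0 ?mulr_gt0.
(* The solution of w = (1 - l) x' + l y'. Both w - z and (1 - l)(x - x') are smaller than l e / 2,
   so y' is within e of y and lies in A. *)
pose y' := y + l^-1 *: ((w - z) + (1 - l) *: (x - x')).
have -> : w = (1 - l) *: x' + l *: y'.
  rewrite /y' scalerDr scalerA mulfV ?gt_eqF// scale1r scalerBr /z.
  by rewrite addrCA !addrA; apply/rowP => i; rewrite !mxE; ring.
apply: convex_setP => //; first by rewrite ltW.
apply: yeA; rewrite -ball_normE/= opprD addrA subrr sub0r normrN normrZ.
rewrite gtr0_norm ?invr_gt0// mulrC ltr_pdivrMr// mulrC [ltRHS]splitr.
move: zw xx'; rewrite -!ball_normE/= => zw xx'.
rewrite (le_lt_trans (ler_normD _ _))// ltrD//; first by rewrite distrC.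
rewrite normrZ ger0_norm ?subr_ge0// (le_lt_trans _ xx')//.
by rewrite ler_piMl// gerBl ltW.
Qed.

Lemma measurable_closure_rV A : measurable (closure A).
Proof. apply: closed_measurable_rV; exact: closed_closure. Qed.

Lemma measurable_interior_rV A : measurable A°.
Proof. apply: open_measurable_rV; exact: open_interior. Qed.

Lemma bounded_closure_rV A (M : R) : (forall x, A x -> forall i, `|x ord0 i| <= M) ->
  forall x, closure A x -> forall i, `|x ord0 i| <= M.
Proof.
move=> AM x clx i; apply/ler_addgt0Pr => e e0.
have [y [Ay /rV_ballP -/(_ e0) xy]] := clx _ (nbhsx_ballx x _ e0).
rewrite -[x ord0 i](subrK (y ord0 i)) (le_trans (ler_normD _ _))// addrC.
by rewrite lerD ?AM// ltW.
Qed.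

(** The case k = 0 of [bbl_rV]: a real c strictly between the integral of h and the minimum would
    contradict it. *)
Lemma bbl_min_rV (al be : R) (f g h : 'rV[R]_n -> \bar R) : 0 < al -> 0 < be ->
  measurable_fun setT f -> measurable_fun setT g -> measurable_fun setT h ->
  (forall x, 0 <= f x)%E -> (forall x, 0 <= g x)%E -> (forall x, 0 <= h x)%E ->
  bbl_rel al be n (fun x y => al *: x + be *: y) f g h ->
  (Order.min (\int[borel]_x f x) (\int[borel]_x g x) <= \int[borel]_x h x)%E.
Proof.
move=> al0 be0 mf mg mh f0 g0 h0 fgh; rewrite leNgt; apply/negP => hfg.
have Ih0 : (0 <= \int[borel]_x h x)%E by exact: integral_ge0.
have [c hc] : exists c, (\int[borel]_x h x < c%:E)%E /\
    (c%:E < Order.min (\int[borel]_x f x) (\int[borel]_x g x))%E.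
  move: hfg; case: (\int[borel]_x h x)%E Ih0 => [r _| _|//]; last by rewrite ltNge leey.
  case: (Order.min _ _) => [s| _|//]; last by exists (r + 1); rewrite lte_fin ltrDl ltr01 ltry.
  by rewrite lte_fin => rs; exists ((r + s) / 2); rewrite !lte_fin; lra.
case: hc => hc'; rewrite lt_min => /andP[cf cg].
have c0 : 0 < c by rewrite -lte_fin (le_lt_trans Ih0).
have fgh0 : bbl_rel al be (n + 0) (fun x y => al *: x + be *: y) f g h by rewrite addn0.
have := bbl_rV al0 be0 mf mg mh f0 g0 h0 fgh0 c0 (@ltr01 R) (@ltr01 R).
by rewrite !expr0 divr1 => /(_ cf cg); rewrite leNgt hc'.
Qed.

(* Lebesgue measure is compared on (1 - e) (closure A) + e A°, which lies in A°,
   by taking g = +oo on A°. *)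
Lemma convex_boundary_null A : bounded_set A ->
  convex_set (A : set (convex_lmodType 'rV[R]_n)) -> A° !=set0 ->
  borel (closure A `\` A°) = 0%E.
Proof.
move=> /bounded_setP[M M0 AM] cA A0.
have clM := bounded_closure_rV AM.
have mK := measurable_closure_rV A; have mO := measurable_interior_rV A.
have OK : A° `<=` closure A by apply: subset_trans (@subset_closure _ A); exact: interior_subset.
have Kfin : (borel (closure A) < +oo)%E by exact: borel_lebesgue_bounded mK clM.
have Ofin : (borel A° < +oo)%E by apply: le_lt_trans Kfin; apply: le_measure; rewrite ?inE.
have Opos : (0 < borel A°)%E by apply: borel_lebesgue_open_gt0 => //; exact: open_interior.
set V := fine (borel (closure A)); set v := fine (borel A°).
have VE : borel (closure A) = V%:E by rewrite fineK// ge0_fin_numE.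
have vE : borel A° = v%:E by rewrite fineK// ge0_fin_numE.
have V0 : 0 <= V by rewrite fine_ge0.
have key e : 0 < e < 1 -> (1 - e) ^+ n * V <= v.
  move=> /andP[e0 e1]; have e1' : 0 < 1 - e by rewrite subr_gt0.
  (* The weighted mean of 1 and +oo with exponent -1/n is ((1 - e) + e * 0)^(-n), which is the value
     given to h on the interior. *)
  have := @bbl_min_rV (1 - e) e (fun x => (\1_(closure A) x)%:E)
    (fun x => +oo * (\1_(A°) x)%:E)%E (fun x => (((1 - e) ^+ n)^-1)%:E * (\1_(A°) x)%:E)%E.
  have mi B : measurable B -> measurable_fun setT (fun x : 'rV[R]_n => (\1_B x : R)%:E).
    by move=> mB; apply/measurable_EFinP; exact: measurable_indic.
  have IK : (\int[borel]_x (\1_(closure A) x)%:E = V%:E)%E.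
    by rewrite integral_indic// setIT; exact: VE.
  have IO : (\int[borel]_x (\1_(A°) x)%:E = v%:E)%E.
    by rewrite integral_indic// setIT; exact: vE.
  rewrite ge0_integralZl//; last exact: (mi _ mO).
  rewrite ge0_integralZl//; last 2 first.
  - exact: (mi _ mO).
  - by rewrite lee_fin invr_ge0 exprn_ge0// ltW.
  rewrite IK IO gt0_mulye; last by rewrite -vE.
  rewrite (_ : Order.min _ _ = V%:E); last by apply/min_idPl; rewrite leey.
  rewrite -EFinM lee_fin => H; rewrite mulrC -ler_pdivlMr ?exprn_gt0// mulrC.
  apply: H => //.
  - exact: (mi _ mK).
  - by apply: measurable_funeM; exact: (mi _ mO).
  - by apply: measurable_funeM; exact: (mi _ mO).
  - by move=> x; rewrite mule_ge0// lee_fin// invr_ge0 exprn_ge0// ltW.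
  move=> x y c B C c0 B0 C0; rewrite !indicE.
  have [xK|] := boolP (x \in closure A); last first.
    by rewrite lte_fin ltNge divr_ge0// ?exprn_ge0// ltW.
  have [yO|] := boolP (y \in (A° : set 'rV[R]_n)); last first.
    by rewrite mule0 => _ _; rewrite lte_fin ltNge divr_ge0// ?exprn_ge0// ltW.
  rewrite lte_fin ltr_pdivrMr ?exprn_gt0// mul1r => cB _.
  rewrite (_ : _ \in (A° : set 'rV[R]_n) = true); last first.
    apply: mem_set; apply: segment_interior => //; first by rewrite e0 ltW.
      exact: set_mem xK.
    exact: set_mem yO.
  rewrite -EFinM lee_fin mulr1 ler_pdivrMr ?exprn_gt0 ?addr_gt0 ?mulr_gt0//.
  rewrite (le_trans (ltW cB))// ler_pdivlMl ?exprn_gt0// -exprMn lerXn2r ?nnegrE//.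
  - by rewrite mulr_ge0// ltW.
  - by rewrite addr_ge0// mulr_ge0// ltW.
  - by rewrite lerDl mulr_ge0// ltW.
have Vv : V <= v.
  rewrite leNgt; apply/negP => vV.
  have nV0 : 0 <= n%:R * V by rewrite mulr_ge0.
  pose d := V - v; have d0 : 0 < d by rewrite subr_gt0.
  (* Chosen so that e < 1 and n V e < d. By Bernoulli's inequality [key] would give V - v <= n e V,
     contradicting d = V - v. *)
  pose e := d / (2 * (n%:R * V + d + 1)).
  have D0 : 0 < 2 * (n%:R * V + d + 1) by rewrite mulr_gt0// ltr_wpDl// addr_ge0// ltW.
  have e01 : 0 < e < 1 by rewrite divr_gt0//= ltr_pdivrMr//; lra.
  have bern : 1 - n%:R * e <= (1 - e) ^+ n.
    case/andP: e01 => e0 e1; elim: (n) => [|k IH]; first by rewrite mul0r subr0 expr0.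
    rewrite exprS; apply: (@le_trans _ _ ((1 - e) * (1 - k%:R * e))).
      have : 0 <= k%:R * e ^+ 2 by rewrite mulr_ge0// sqr_ge0.
      by rewrite -natr1; nra.
    by rewrite ler_pM2l// subr_gt0.
  have := key e e01; apply/negP; rewrite -ltNge.
  apply: (@lt_le_trans _ _ ((1 - n%:R * e) * V)); last by rewrite ler_wpM2r.
  have : n%:R * V * e < d.
    by rewrite /e mulrCA gtr_pMr// ltr_pdivrMr//; lra.
  by rewrite /d; nra.
have vV : v <= V by rewrite -lee_fin -VE -vE; apply: le_measure; rewrite ?inE.
transitivity (V%:E - v%:E)%E; last first.
  by rewrite -EFinB; congr EFin; apply/eqP; rewrite subr_eq0 eq_le Vv vV.
by rewrite measureD// (setIidr OK); congr (_ - _)%E; [exact: VE|exact: vE].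
Qed.

(* A itself need not be Borel: it is squeezed between A° and closure A. *)
Lemma integral_convex_body A (F : 'rV[R]_n -> R) : bounded_set A ->
  convex_set (A : set (convex_lmodType 'rV[R]_n)) -> A° !=set0 ->
  measurable_fun setT F -> (forall x, 0 <= F x) ->
  (\int[lebesgue_rV R n]_x (F x * \1_A x)%:E = \int[borel]_x (F x * \1_(A°) x)%:E)%E.
Proof.
move=> bA cA A0 mF F0.
have mK := measurable_closure_rV A; have mO := measurable_interior_rV A.
have mFi B : measurable B -> measurable_fun setT (fun x : 'rV[R]_n => (F x * \1_B x)%:E).
  by move=> mB; apply/measurable_EFinP; apply: measurable_funM => //; exact: measurable_indic.
have Fi0 B x : (0 <= (F x * \1_B x)%:E)%E by rewrite lee_fin mulr_ge0.
have FiS B C : B `<=` C -> forall x, ((F x * \1_B x)%:E <= (F x * \1_C x)%:E)%E.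
  move=> BC x; rewrite lee_fin ler_wpM2l// !indicE.
  by case: (boolP (x \in B)) => // /set_mem/BC/mem_set ->.
have Fi B : measurable B -> (\int[borel]_x (F x * \1_B x)%:E = \int[borel]_(x in B) (F x)%:E)%E.
  move=> mB; rewrite [RHS]integral_mkcond; apply: eq_integral => x _.
  by rewrite patchE indicE; case: (x \in B); rewrite ?mulr1 ?mulr0.
apply/eqP; rewrite eq_le; apply/andP; split.
  apply: (@le_trans _ _ (\int[lebesgue_rV R n]_x (F x * \1_(closure A) x)%:E)%E).
    by apply: ge0_le_integral_nonmeasurable => //; apply: FiS; exact: subset_closure.
  rewrite (@ge0_integral_lebesgue_rV _ _ (fun x => (F x * \1_(closure A) x)%:E))//; last exact: mFi.
  rewrite !Fi// (@ge0_negligible_integral _ _ _ borel _ (closure A `\` A°))//.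
  - by rewrite setDD setIC setIidl//; apply: subset_trans (@subset_closure _ A); exact: interior_subset.
  - exact: measurableD.
  - by apply/measurable_EFinP; exact: measurable_funTS.
  - by move=> x _; rewrite lee_fin.
  - exact: convex_boundary_null.
rewrite -(@ge0_integral_lebesgue_rV _ _ (fun x => (F x * \1_(A°) x)%:E))//; last exact: mFi.
by apply: ge0_le_integral_nonmeasurable => //; apply: FiS; exact: interior_subset.
Qed.

End convex_body.

(** * The Poisson kernel *)

Section poisson_kernel.
Context {R : realType} {n : nat}.
Implicit Types (v w x y : 'rV[R]_n) (s t : R).

Definition half_norm v t : R := Num.sqrt (\sum_i v ord0 i ^+ 2 + t ^+ 2).

Lemma half_norm_sqr v t : half_norm v t ^+ 2 = \sum_i v ord0 i ^+ 2 + t ^+ 2.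
Proof. by rewrite sqr_sqrtr// addr_ge0 ?sqr_ge0// sumr_ge0// => i _; rewrite sqr_ge0. Qed.

Lemma half_norm_ge v t : 0 < t -> t <= half_norm v t.
Proof.
move=> t0; rewrite -(ler_pXn2r (n:=2)) ?nnegrE ?sqrtr_ge0 ?(ltW t0)//.
by rewrite half_norm_sqr lerDr sumr_ge0// => i _; rewrite sqr_ge0.
Qed.

Lemma half_norm_gt0 v t : 0 < t -> 0 < half_norm v t.
Proof. by move=> t0; exact: lt_le_trans (half_norm_ge v t0). Qed.

(** The defect in the triangle inequality is a multiple of the Cauchy-Schwarz gap of (v, s) and (w,
    t), which [half_norm_gap] bounds below. *)
Lemma half_norm_conv_sqr (al be : R) v w s t :
  half_norm (al *: v + be *: w) (al * s + be * t) ^+ 2 =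
  (al * half_norm v s + be * half_norm w t) ^+ 2 -
  2 * al * be * (half_norm v s * half_norm w t - (\sum_i v ord0 i * w ord0 i + s * t)).
Proof.
set p := half_norm v s; set q := half_norm w t.
have -> : (al * p + be * q) ^+ 2 = al ^+ 2 * p ^+ 2 + be ^+ 2 * q ^+ 2 + 2 * al * be * (p * q).
  by ring.
rewrite /p /q !half_norm_sqr -/p -/q.
have -> : \sum_i (al *: v + be *: w) ord0 i ^+ 2 =
    al ^+ 2 * (\sum_i v ord0 i ^+ 2) + be ^+ 2 * (\sum_i w ord0 i ^+ 2)
    + 2 * al * be * \sum_i v ord0 i * w ord0 i.
  by rewrite !mulr_sumr -!big_split/=; apply: eq_bigr => i _; rewrite !mxE; ring.
by ring.
Qed.

(* Lagrange's identity for the vectors (v, s) and (w, t), bounded below by one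
   of its 2 x 2 minors. *)
Lemma half_norm_gap v w s t (i : 'I_n) : 0 < s -> 0 < t ->
  (t * v ord0 i - s * w ord0 i) ^+ 2 / 2 <=
  half_norm v s * half_norm w t *
  (half_norm v s * half_norm w t - (\sum_j v ord0 j * w ord0 j + s * t)).
Proof.
move=> s0 t0; set p := half_norm v s; set q := half_norm w t.
have p0 : 0 < p by exact: half_norm_gt0.
have q0 : 0 < q by exact: half_norm_gt0.
pose a j := q * v ord0 j - p * w ord0 j; pose b := q * s - p * t.
(* The left side is the squared norm of q (v, s) - p (w, t), a difference of two vectors of equal
   norm p q. *)
have sumE : \sum_j a j ^+ 2 + b ^+ 2 = 2 * (p * q) * (p * q - (\sum_j v ord0 j * w ord0 j + s * t)).
  have -> : \sum_j a j ^+ 2 = q ^+ 2 * (\sum_j v ord0 j ^+ 2) + p ^+ 2 * (\sum_j w ord0 j ^+ 2)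
     - 2 * (p * q) * \sum_j v ord0 j * w ord0 j.
    by rewrite !mulr_sumr -sumrN -!big_split/=; apply: eq_bigr => j _; rewrite /a; ring.
  have -> : \sum_j v ord0 j ^+ 2 = p ^+ 2 - s ^+ 2 by rewrite half_norm_sqr addrK.
  have -> : \sum_j w ord0 j ^+ 2 = q ^+ 2 - t ^+ 2 by rewrite half_norm_sqr addrK.
  by rewrite /b; ring.
have le_sum : a i ^+ 2 + b ^+ 2 <= \sum_j a j ^+ 2 + b ^+ 2.
  by rewrite lerD2r (bigD1 i)//= lerDl sumr_ge0// => j _; rewrite sqr_ge0.
have wq : t ^+ 2 + w ord0 i ^+ 2 <= q ^+ 2.
  by rewrite half_norm_sqr addrC lerD2r (bigD1 i)//= lerDl sumr_ge0// => j _; rewrite sqr_ge0.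
set X := t * v ord0 i - s * w ord0 i.
(* Eliminating p expresses the minor through a_i and b; Cauchy-Schwarz in the plane and t^2 + w_i^2
   <= q^2 then give X^2 <= a_i^2 + b^2. *)
have XE : q * X = t * a i - w ord0 i * b by rewrite /X /a /b; ring.
have : q ^+ 2 * X ^+ 2 <= q ^+ 2 * (a i ^+ 2 + b ^+ 2).
  rewrite -exprMn XE; apply: (@le_trans _ _ ((t ^+ 2 + w ord0 i ^+ 2) * (a i ^+ 2 + b ^+ 2))).
    rewrite -subr_ge0.
    have -> : (t ^+ 2 + w ord0 i ^+ 2) * (a i ^+ 2 + b ^+ 2) - (t * a i - w ord0 i * b) ^+ 2 =
       (t * b + w ord0 i * a i) ^+ 2 by ring.
    exact: sqr_ge0.
  by rewrite ler_wpM2r// addr_ge0// sqr_ge0.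
rewrite ler_pM2l ?exprn_gt0// => /le_trans/(_ le_sum).
rewrite sumE -/p -/q => H; rewrite ler_pdivrMr//; apply: le_trans H _.
by rewrite le_eqVlt; apply/orP; left; apply/eqP; ring.
Qed.

Lemma half_norm_conv_le (al be : R) v w s t : 0 <= al -> 0 <= be -> 0 < s -> 0 < t ->
  half_norm (al *: v + be *: w) (al * s + be * t) <=
  al * half_norm v s + be * half_norm w t.
Proof.
move=> al0 be0 s0 t0.
have p0 := half_norm_gt0 v s0; have q0 := half_norm_gt0 w t0.
rewrite -(ler_pXn2r (n:=2)) ?nnegrE ?sqrtr_ge0//; last first.
  by rewrite addr_ge0// mulr_ge0// ltW.
rewrite half_norm_conv_sqr gerBl !mulr_ge0//.
have [i|n0] := pickP (fun i : 'I_n => true).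
  move=> _; have := half_norm_gap v w i s0 t0.
  have : 0 <= (t * v ord0 i - s * w ord0 i) ^+ 2 / 2 by rewrite divr_ge0// sqr_ge0.
  by move=> /le_trans/[apply]; rewrite pmulr_rge0// mulr_gt0.
(* In dimension 0 there is no minor to use, and the gap is p q - s t. *)
rewrite big1 ?add0r; last by move=> i; have := n0 i.
by rewrite subr_ge0 ler_pM ?(ltW s0) ?(ltW t0) ?half_norm_ge.
Qed.

(** A uniform strict triangle inequality: a minor of size at least eta makes the Cauchy-Schwarz gap
    at least eta^2 / (2 M^2), so the square of S drops by at least rho M^2 >= rho S^2. The maximum
    with 1/2 keeps [kap] positive. *)
Lemma half_norm_conv_lt (al be M eta : R) (i : 'I_n) : 0 < al -> 0 < be ->
  al + be = 1 -> 0 < M -> 0 < eta ->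
  exists2 kap, 0 < kap < 1 & forall v w s t, 0 < s -> 0 < t ->
    half_norm v s <= M -> half_norm w t <= M ->
    eta <= `|t * v ord0 i - s * w ord0 i| ->
    half_norm (al *: v + be *: w) (al * s + be * t) <=
    kap * (al * half_norm v s + be * half_norm w t).
Proof.
move=> al0 be0 albe M0 eta0.
pose rho := al * be * eta ^+ 2 / M ^+ 4.
have rho0 : 0 < rho by rewrite divr_gt0 ?exprn_gt0// !mulr_gt0// exprn_gt0.
pose kap := Num.max (2^-1) (Num.sqrt (1 - rho)).
exists kap.
  rewrite lt_max invr_gt0 ltr0n/= gt_max invf_lt1// ltr1n/=.
  by rewrite -[ltRHS]sqrtr1 ltr_sqrt// ltrBlDr ltrDl.
move=> v w s t s0 t0 vM wM etaX.
set p := half_norm v s in vM *; set q := half_norm w t in wM *.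
have p0 : 0 < p by exact: half_norm_gt0.
have q0 : 0 < q by exact: half_norm_gt0.
set S := al * p + be * q; have S0 : 0 < S by rewrite addr_gt0// mulr_gt0.
have SM : S <= M.
  by rewrite -[leRHS]mul1r -albe mulrDl lerD// ler_pM2l.
apply: (@le_trans _ _ (Num.sqrt (1 - rho) * S)); last first.
  by rewrite ler_pM2r// le_max lexx orbT.
have -> : Num.sqrt (1 - rho) * S = Num.sqrt ((1 - rho) * S ^+ 2).
  by rewrite mulrC [in RHS]mulrC sqrtrM ?sqr_ge0// sqrtr_sqr gtr0_norm.
rewrite -[leLHS]ger0_norm ?sqrtr_ge0// -sqrtr_sqr ler_wsqrtr//.
rewrite half_norm_conv_sqr -/p -/q -/S mulrBl mul1r lerD2l lerN2.
set G := p * q - _.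
have pq0 : 0 < p * q by rewrite mulr_gt0.
have gap : eta ^+ 2 / 2 <= p * q * G.
  apply: le_trans (half_norm_gap v w i s0 t0); rewrite ler_pM2r ?invr_gt0//.
  by rewrite -[leRHS]real_normK ?num_real// ler_pXn2r// nnegrE ltW.
have G0 : 0 <= G by rewrite -(pmulr_rge0 _ pq0) (le_trans _ gap)// divr_ge0// sqr_ge0.
have gapM : eta ^+ 2 / 2 <= M ^+ 2 * G.
  by apply: le_trans gap _; rewrite ler_wpM2r// expr2 ler_pM// ltW.
apply: (@le_trans _ _ (rho * M ^+ 2)).
  by rewrite ler_pM2l// ler_pXn2r// nnegrE ltW.
have -> : rho * M ^+ 2 = (2 * al * be) * (eta ^+ 2 / 2 / M ^+ 2).
  by rewrite /rho; field; rewrite gt_eqF.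
by rewrite ler_pM2l ?mulr_gt0// ler_pdivrMr ?exprn_gt0// [leRHS]mulrC.
Qed.

Lemma half_norm_le v (M : R) t : (forall i, `|v ord0 i| <= M) ->
  half_norm v t <= half_norm (const_mx M) t.
Proof.
move=> vM; rewrite ler_wsqrtr// lerD2r ler_sum// => i _.
have M0 : 0 <= M by exact: le_trans (vM i).
by rewrite mxE -[leLHS]real_normK ?num_real// ler_pXn2r// nnegrE.
Qed.

(** The Poisson kernel without the factor 2 / sigma_n. A natural power of the norm replaces the real
    power of its square, so that [perspective_convex] applies. *)
Definition poisson_kernel x t y : R := t / half_norm (x - y) t ^+ n.+1.

Lemma poisson_kernel_ge0 x t y : 0 < t -> 0 <= poisson_kernel x t y.
Proof. by move=> t0; rewrite divr_ge0 ?exprn_ge0 ?sqrtr_ge0// ltW. Qed.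

Lemma poisson_kernel_le x t y : 0 < t -> poisson_kernel x t y <= t / t ^+ n.+1.
Proof.
move=> t0; rewrite ler_pM2l// lef_pV2 ?posrE ?exprn_gt0 ?half_norm_gt0//.
by rewrite ler_pXn2r ?nnegrE ?half_norm_ge ?sqrtr_ge0// ltW.
Qed.

Lemma poisson_kernel_ge x t y (M : R) : 0 < t -> (forall i, `|(x - y) ord0 i| <= M) ->
  t / half_norm (const_mx M : 'rV[R]_n) t ^+ n.+1 <= poisson_kernel x t y.
Proof.
move=> t0 xyM; rewrite ler_pM2l// lef_pV2 ?posrE ?exprn_gt0 ?half_norm_gt0//.
by rewrite ler_pXn2r ?nnegrE ?sqrtr_ge0 ?half_norm_le.
Qed.

Lemma poisson_kernelE x t y : 0 < t -> poisson_kernel x t y =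
  t * (enorm (x - y) ^+ 2 + t ^+ 2) `^ (- (n.+1%:R / 2)).
Proof.
move=> t0; rewrite /poisson_kernel; congr (_ * _).
have -> : enorm (x - y) ^+ 2 + t ^+ 2 = half_norm (x - y) t ^+ 2.
  by rewrite half_norm_sqr /enorm sqr_sqrtr// sumr_ge0// => i _; rewrite sqr_ge0.
rewrite -[in RHS]powR_mulrn ?sqrtr_ge0// -powRrM mulrN mulrCA divff// mulr1.
by rewrite powRN powR_mulrn// sqrtr_ge0.
Qed.

Lemma measurable_poisson_kernel x t : 0 < t -> measurable_fun setT (poisson_kernel x t).
Proof.
move=> t0; rewrite (_ : poisson_kernel x t = (fun u => t * u `^ (- (n.+1%:R / 2))) \o
    (fun y => \sum_i (x ord0 i - y ord0 i) ^+ 2 + t ^+ 2)).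
  apply: measurableT_comp; first by apply: measurable_funM => //; exact: measurable_powR.
  apply: measurable_funD => //; apply: measurable_sum => i.
  apply: measurable_funX; apply: measurable_funB => //; exact: measurable_rV_coord.
apply/funext => y /=; rewrite poisson_kernelE//; congr (_ * (_ + _) `^ _).
rewrite /enorm sqr_sqrtr; first by apply: eq_bigr => i _; rewrite !mxE.
by rewrite sumr_ge0// => i _; rewrite sqr_ge0.
Qed.

(** The two kernel bounds read c p^(n+1) / A^n < t0 and c q^(n+1) / B^n < t1; convexity of the
    perspective combines them into a bound on (al p + be q)^(n+1). The factor kap is 1 for the plain
    triangle inequality and less than 1 where it is uniformly strict. *)
Lemma poisson_kernel_bbl (al be kap : R) x0 x1 t0 t1 y0 y1 c A B :
  0 < al -> 0 < be -> 0 < kap -> 0 < t0 -> 0 < t1 -> 0 < c -> 0 < A -> 0 < B ->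
  half_norm (al *: (x0 - y0) + be *: (x1 - y1)) (al * t0 + be * t1) <=
    kap * (al * half_norm (x0 - y0) t0 + be * half_norm (x1 - y1) t1) ->
  c / A ^+ n < poisson_kernel x0 t0 y0 -> c / B ^+ n < poisson_kernel x1 t1 y1 ->
  c / (al * A + be * B) ^+ n <=
  kap ^+ n.+1 * poisson_kernel (al *: x0 + be *: x1) (al * t0 + be * t1)
                               (al *: y0 + be *: y1).
Proof.
move=> al0 be0 kap0 t00 t10 c0 A0 B0; rewrite /poisson_kernel.
have -> : al *: x0 + be *: x1 - (al *: y0 + be *: y1) = al *: (x0 - y0) + be *: (x1 - y1).
  by apply/rowP => i; rewrite !mxE; ring.
have tl0 : 0 < al * t0 + be * t1 by rewrite addr_gt0// mulr_gt0.
set r := half_norm (al *: (x0 - y0) + _) _; set p := half_norm (x0 - y0) t0.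
set q := half_norm (x1 - y1) t1 => rpq.
have p0 : 0 < p by exact: half_norm_gt0.
have q0 : 0 < q by exact: half_norm_gt0.
have r0 : 0 < r by exact: half_norm_gt0.
set S := al * A + be * B; have S0 : 0 < S by rewrite addr_gt0// mulr_gt0.
rewrite ltr_pdivlMr ?exprn_gt0// => cp; rewrite ltr_pdivlMr ?exprn_gt0// => cq.
rewrite mulrA ler_pdivlMr ?exprn_gt0//.
apply: (@le_trans _ _ (kap ^+ n.+1 * (c * ((al * p + be * q) ^+ n.+1 / S ^+ n)))).
  rewrite (_ : _ * (c * _) = c / S ^+ n * (kap * (al * p + be * q)) ^+ n.+1); last first.
    by rewrite exprMn; ring.
  rewrite ler_pM2l ?divr_gt0 ?exprn_gt0// ler_pXn2r ?nnegrE ?(ltW r0)//.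
  by rewrite mulr_ge0 ?addr_ge0 ?mulr_ge0// ltW.
rewrite ler_pM2l ?exprn_gt0//.
apply: (@le_trans _ _ (c * (al * (p ^+ n.+1 / A ^+ n) + be * (q ^+ n.+1 / B ^+ n)))).
  by rewrite ler_pM2l//; apply: perspective_convex => //; exact: ltW.
rewrite (_ : c * _ = al * (c / A ^+ n * p ^+ n.+1) + be * (c / B ^+ n * q ^+ n.+1)).
  by rewrite lerD// ler_pM2l// ltW.
by ring.
Qed.

End poisson_kernel.

(** * Integrals of a weight over a set *)

Section weighted_volume.
Context {R : realType} {n : nat}.
Local Notation borel := (@borel_lebesgue_rV R n).
Implicit Types (F G H : 'rV[R]_n -> R) (B C D : set 'rV[R]_n).

Definition weighted_volume F B : \bar R := (\int[borel]_y (F y * \1_B y)%:E)%E.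

Lemma measurable_weight F B : measurable_fun setT F -> measurable B ->
  measurable_fun setT (fun y => (F y * \1_B y)%:E).
Proof.
by move=> mF mB; apply/measurable_EFinP; apply: measurable_funM => //; exact: measurable_indic.
Qed.

Lemma weighted_volume_ge0 F B : (forall y, 0 <= F y) -> (0 <= weighted_volume F B)%E.
Proof. by move=> F0; apply: integral_ge0 => y _; rewrite lee_fin mulr_ge0. Qed.

Lemma weighted_volumeZ F B (k : R) : measurable_fun setT F -> (forall y, 0 <= F y) ->
  measurable B -> 0 <= k ->
  (weighted_volume (fun y => k * F y)%R B = k%:E * weighted_volume F B)%E.
Proof.
move=> mF F0 mB k0; rewrite /weighted_volume -ge0_integralZl//.
- by apply: eq_integral => y _; rewrite -mulrA EFinM.
- exact: measurable_weight.
- by move=> y _; rewrite lee_fin mulr_ge0.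
Qed.

Lemma weighted_volumeU F B C : measurable_fun setT F -> (forall y, 0 <= F y) ->
  measurable B -> measurable C -> B `&` C = set0 ->
  (weighted_volume F (B `|` C) = weighted_volume F B + weighted_volume F C)%E.
Proof.
move=> mF F0 mB mC BC0; rewrite /weighted_volume -ge0_integralD//.
- apply: eq_integral => y _; rewrite -EFinD -mulrDr; congr (_ * _)%:E.
  rewrite !indicE in_setU.
  have [yB|] := boolP (y \in B); have [yC|] := boolP (y \in C) => //=; rewrite ?addr0 ?add0r//.
  move: (BC0); rewrite -subset0 => /(_ y); case.
  by split; exact: set_mem.
- by move=> y _; rewrite lee_fin mulr_ge0.
- exact: measurable_weight.
- by move=> y _; rewrite lee_fin mulr_ge0.
- exact: measurable_weight.
Qed.

Lemma weighted_volume_le F B (K : R) : measurable_fun setT F -> (forall y, 0 <= F y) ->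
  measurable B -> (forall y, B y -> F y <= K) -> (weighted_volume F B <= K%:E * borel B)%E.
Proof.
move=> mF F0 mB FK; have [/eqP->|/set0P[y0 By0]] := boolP (B == set0).
  rewrite measure0 mule0 /weighted_volume integral0_eq// => y _.
  by rewrite indicE in_set0 mulr0.
have K0 : 0 <= K by rewrite (le_trans (F0 y0))// FK.
rewrite -[X in (_ * borel X)%E]setIT -integral_indic// -ge0_integralZl//; last first.
  by apply/measurable_EFinP; exact: measurable_indic.
apply: ge0_le_integral => //.
- by move=> y _; rewrite lee_fin mulr_ge0.
- exact: measurable_weight.
- by apply: measurable_funeM; apply/measurable_EFinP; exact: measurable_indic.
move=> y _; rewrite -EFinM lee_fin indicE.
by have [/set_mem By|] := boolP (y \in B); rewrite ?mulr1 ?mulr0// FK.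
Qed.

Lemma weighted_volume_ge F B (k : R) : measurable_fun setT F -> (forall y, 0 <= F y) ->
  measurable B -> 0 <= k -> (forall y, B y -> k <= F y) ->
  (k%:E * borel B <= weighted_volume F B)%E.
Proof.
move=> mF F0 mB k0 kF.
rewrite -[X in (_ * borel X)%E]setIT -integral_indic// -ge0_integralZl//; last first.
  by apply/measurable_EFinP; exact: measurable_indic.
apply: ge0_le_integral => //.
- by move=> y _; rewrite -EFinM lee_fin mulr_ge0.
- by apply: measurable_funeM; apply/measurable_EFinP; exact: measurable_indic.
- exact: measurable_weight.
move=> y _; rewrite -EFinM lee_fin indicE.
by have [/set_mem By|] := boolP (y \in B); rewrite ?mulr1 ?mulr0// kF.
Qed.

(** Outside B and C the weights vanish and cannot exceed the positive thresholds, so the relation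
    has to be checked on B and C only. *)
Lemma weighted_volume_bbl (al be : R) F G H B C D : 0 < al -> 0 < be ->
  measurable_fun setT F -> measurable_fun setT G -> measurable_fun setT H ->
  (forall y, 0 <= F y) -> (forall y, 0 <= G y) -> (forall y, 0 <= H y) ->
  measurable B -> measurable C -> measurable D ->
  (forall y z, B y -> C z -> D (al *: y + be *: z)) ->
  (forall y z c P Q, B y -> C z -> 0 < c -> 0 < P -> 0 < Q ->
     c / P ^+ n < F y -> c / Q ^+ n < G z ->
     c / (al * P + be * Q) ^+ n <= H (al *: y + be *: z)) ->
  (Order.min (weighted_volume F B) (weighted_volume G C) <= weighted_volume H D)%E.
Proof.
move=> al0 be0 mF mG mH F0 G0 H0 mB mC mD BCD FGH.
have w0 (L : 'rV[R]_n -> R) (X : set 'rV[R]_n) : (forall y, 0 <= L y) ->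
    forall y, (0 <= (L y * \1_X y)%:E)%E.
  by move=> L0 y; rewrite lee_fin mulr_ge0.
apply: (bbl_min_rV al0 be0) => //; try (by apply: measurable_weight); try exact: w0.
move=> y z c P Q c0 P0 Q0; rewrite !indicE.
have [/set_mem yB|] := boolP (y \in B); last first.
  by rewrite mulr0 lte_fin ltNge divr_ge0// ?exprn_ge0// ltW.
have [/set_mem zC|] := boolP (z \in C); last first.
  by rewrite mulr0 => _ _; rewrite lte_fin ltNge divr_ge0// ?exprn_ge0// ltW.
rewrite (mem_set (BCD y z yB zC)) !mulr1 !lte_fin lee_fin.
exact: FGH.
Qed.

End weighted_volume.

(** * Cutting by hyperplanes *)

Section slabs.
Context {R : realType} {n : nat}.
Local Notation borel := (@borel_lebesgue_rV R n).
Variables (O : set 'rV[R]_n) (M : R) (e : R) (i : 'I_n).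
Hypotheses (mO : measurable O) (M0 : 0 < M).
Hypothesis OM : forall y, O y -> forall j, `|y ord0 j| <= M.
Hypothesis e1 : e * e = 1.

(** Since e * e = 1, e is a sign, and the cuts proceed along the i-th axis in either direction. *)
Definition slab_lt (a : R) : set 'rV[R]_n := O `&` [set y | e * y ord0 i < a].
Definition slab_ge (a : R) : set 'rV[R]_n := O `&` [set y | a <= e * y ord0 i].

Let mcoord : measurable_fun setT (fun y : 'rV[R]_n => e * y ord0 i).
Proof. by apply: measurable_funM => //; exact: measurable_rV_coord. Qed.

Lemma measurable_slab_lt a : measurable (slab_lt a).
Proof.
rewrite (_ : slab_lt a = O `&` ((fun y : 'rV[R]_n => e * y ord0 i) @^-1` `]-oo, a[)).
  apply: measurableI => //; rewrite -[X in measurable X]setTI.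
  by apply: mcoord => //; exact: measurable_itv.
by apply/seteqP; split => y [Oy]; rewrite /= in_itv.
Qed.

Lemma measurable_slab_ge a : measurable (slab_ge a).
Proof.
rewrite (_ : slab_ge a = O `&` ((fun y : 'rV[R]_n => e * y ord0 i) @^-1` `[a, +oo[)).
  apply: measurableI => //; rewrite -[X in measurable X]setTI.
  by apply: mcoord => //; exact: measurable_itv.
by apply/seteqP; split => y [Oy]; rewrite /= in_itv/= andbT.
Qed.

Lemma slabU a : slab_lt a `|` slab_ge a = O.
Proof.
apply/seteqP; split => [y [[]|[]]//|y Oy].
by have [ya|ay] := ltP (e * y ord0 i) a; [left|right].
Qed.

Lemma slabI a : slab_lt a `&` slab_ge a = set0.
Proof.
by rewrite -subset0 => y [[_ /= ya] [_ /= ay]]; move: ya; rewrite ltNge ay.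
Qed.

Let e_norm : `|e| = 1.
Proof. by apply/eqP; rewrite -(@pexpr_eq1 _ _ 2)// -normrX expr2 e1 normr1. Qed.

Let coord_le y : O y -> `|e * y ord0 i| <= M.
Proof. by move=> Oy; rewrite normrM e_norm mul1r OM. Qed.

Variables (F : 'rV[R]_n -> R) (K : R).
Hypotheses (mF : measurable_fun setT F) (F0 : forall y, 0 <= F y).
Hypothesis FK : forall y, F y <= K.

Lemma weighted_volume_fin B : measurable B -> B `<=` O -> weighted_volume F B \is a fin_num.
Proof.
move=> mB BO; rewrite ge0_fin_numE ?weighted_volume_ge0//.
apply: (le_lt_trans (weighted_volume_le mF F0 mB (fun y _ => FK y))).
rewrite lte_mul_pinfty//; first by rewrite lee_fin (le_trans (F0 0)).
by apply: (@borel_lebesgue_bounded _ _ _ M) => // y /BO; exact: OM.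
Qed.

Let Phi a := fine (weighted_volume F (slab_lt a)).

Let PhiE a : weighted_volume F (slab_lt a) = (Phi a)%:E.
Proof.
by rewrite fineK//; apply: weighted_volume_fin; [exact: measurable_slab_lt|move=> y []].
Qed.

(** The part of O between the levels a and a' fits in a box of width 2 (a' - a) in direction i and 2
    (M + 1) in the n - 1 others, and F <= K there. The 1 added to L keeps it positive. *)
Let Phi_lipschitz : exists2 L, 0 < L & forall a a', a <= a' -> `|Phi a' - Phi a| <= L * (a' - a).
Proof.
have K0 : 0 <= K by rewrite (le_trans (F0 0)).
have N0 : 0 < 2 * (M + 1) by rewrite mulr_gt0// addr_gt0.
pose L := K * (2 * (2 * (M + 1)) ^+ n.-1) + 1.
exists L; first by rewrite ltr_wpDl// !mulr_ge0// exprn_ge0// ltW.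
move=> a a' aa'; set d := a' - a.
have d0 : 0 <= d by rewrite subr_ge0.
pose S := slab_lt a' `&` slab_ge a.
have mS : measurable S by apply: measurableI; [exact: measurable_slab_lt|exact: measurable_slab_ge].
have SE : slab_lt a' = slab_lt a `|` S.
  apply/seteqP; split => [y [Oy ya']|y [[Oy ya]|[]//]].
    have [ya|ay] := ltP (e * y ord0 i) a; [by left|by right].
  by split => //=; exact: lt_le_trans aa'.
have S0 : slab_lt a `&` S = set0.
  by rewrite -subset0 => y [ya [_ ay]]; rewrite -(slabI a); split.
have WS : (weighted_volume F S <= (L * d)%:E)%E.
  apply: (le_trans (weighted_volume_le mF F0 mS (fun y _ => FK y))).
  (* Centring the box at e * a covers both signs, as y_i - e a = e (e y_i - a). *)
  pose lo j := if j == i then e * a - d else - (M + 1).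
  pose hi j := if j == i then e * a + d else M + 1.
  have : (borel S <= (2 * d * (2 * (M + 1)) ^+ n.-1)%:E)%E.
    apply: (@le_trans _ _ (borel [set y | forall j, lo j <= y ord0 j < hi j])).
      apply: le_measure; rewrite ?inE//; first exact: measurable_rV_box.
      move=> y [[Oy /= ya'] [_ /= ay]] j; rewrite /lo /hi.
      have [->|_] := eqVneq j i.
        have : `|y ord0 i - e * a| < d.
          have -> : y ord0 i - e * a = e * (e * y ord0 i - a) by rewrite mulrBr mulrA e1 mul1r.
          by rewrite normrM e_norm mul1r ger0_norm ?subr_ge0// ltrD2r.
        by rewrite ltr_distl => /andP[/ltW -> ->].
      have := OM Oy j; rewrite ler_norml => /andP[h1 h2].
      by apply/andP; split; lra.
    rewrite borel_lebesgue_box => [|j]; last first.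
      rewrite /lo /hi; case: eqP => _; first by lra.
      by rewrite (@le_trans _ _ 0)// ?oppr_le0 addr_ge0// ltW.
    rewrite lee_fin (bigD1 i)//= (eq_bigr (fun=> 2 * (M + 1))); last first.
      by move=> j ji; rewrite /lo /hi (negbTE ji); ring.
    rewrite prodr_const cardC1 card_ord /lo /hi eqxx.
    by rewrite (_ : e * a + d - (e * a - d) = 2 * d)//; ring.
  move=> Sd; apply: (@le_trans _ _ (K%:E * (2 * d * (2 * (M + 1)) ^+ n.-1)%:E)%E).
    by rewrite lee_wpmul2l.
  rewrite -EFinM lee_fin /L.
  rewrite (_ : (_ + 1) * d = K * (2 * d * (2 * (M + 1)) ^+ n.-1) + d); first by rewrite lerDl.
  by ring.
have -> : Phi a' - Phi a = fine (weighted_volume F S).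
  apply: EFin_inj; rewrite EFinB -!PhiE SE weighted_volumeU//; last exact: measurable_slab_lt.
  rewrite PhiE addeAC subee// add0e fineK//.
  by apply: weighted_volume_fin => // y [[]].
rewrite ger0_norm ?fine_ge0 ?weighted_volume_ge0//.
rewrite -lee_fin fineK//; apply: weighted_volume_fin => //.
by move=> y [[]].
Qed.

(** The intermediate value theorem for [Phi], from -M, where the slab is empty, to M + 1, where the
    strict inequality holds on all of O. *)
Lemma slab_ivt (s : R) : 0 <= s <= 1 ->
  exists a, weighted_volume F (slab_lt a) = (s%:E * weighted_volume F O)%E.
Proof.
move=> /andP[s0 s1].
have [L L0 PhiL] := Phi_lipschitz.
have cPhi : continuous Phi.
  move=> a; apply/cvgrPdist_lt => eps eps0; apply/nbhs_ballP.
  exists (eps / L) => /=; first by rewrite divr_gt0.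
  move=> b; rewrite /ball/= ltr_pdivlMr// mulrC => ab.
  apply: le_lt_trans ab; have [ab|ba] := leP a b.
    by rewrite distrC [`|a - b|]distrC [in leRHS]ger0_norm ?subr_ge0// PhiL.
  by rewrite [in leRHS]ger0_norm ?subr_ge0 ?PhiL// ltW.
have lowO : slab_lt (- M) = set0.
  rewrite -subset0 => y [Oy /=]; have := coord_le Oy; rewrite ler_norml => /andP[My _].
  by rewrite ltNge My.
have highO : slab_lt (M + 1) = O.
  apply/seteqP; split => [y []//|y Oy]; split => //=.
  by have := coord_le Oy; rewrite ler_norml => /andP[_ yM]; rewrite (le_lt_trans yM)// ltrDl.
have PhiM : Phi (- M) = 0.
  rewrite /Phi lowO /weighted_volume integral0_eq// => y _.
  by rewrite indicE in_set0 mulr0.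
have PhiM1 : weighted_volume F O = (Phi (M + 1))%:E by rewrite -PhiE highO.
have PhiO0 : 0 <= Phi (M + 1) by rewrite fine_ge0// weighted_volume_ge0.
have MM : - M <= M + 1 by rewrite (@le_trans _ _ 0) ?oppr_le0 ?addr_ge0// ltW.
have [|a _ aE] := @IVT R Phi (- M) (M + 1) (s * Phi (M + 1)) MM (continuous_subspaceT cPhi).
  by rewrite PhiM (min_idPl PhiO0) (max_idPr PhiO0) mulr_ge0//= ler_piMl.
by exists a; rewrite PhiE aE PhiM1.
Qed.

End slabs.

(** Here l is the infimum of e y_i over O, and the last hypothesis says that (x0 - y, t0) and (x1 -
    z, t1) are not parallel when y and z both sit at that lower end. The slabs near this end gain a
    factor; the others satisfy the plain inequality. *)
Lemma poisson_volume_strict (R : realType) (n : nat) (O : set 'rV[R]_n)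
    (al be M l e : R) (i : 'I_n) (x0 x1 : 'rV[R]_n) (t0 t1 : R) :
  open O -> 0 < M -> (forall y, O y -> forall j, `|y ord0 j| <= M) ->
  0 < al -> 0 < be -> al + be = 1 ->
  (forall y z, O y -> O z -> O (al *: y + be *: z)) ->
  0 < t0 -> 0 < t1 -> e * e = 1 ->
  (forall y, O y -> l <= e * y ord0 i) ->
  (forall b, l < b -> exists2 y, O y & e * y ord0 i < b) ->
  (e * x0 ord0 i - l) * t1 < (e * x1 ord0 i - l) * t0 ->
  (Order.min (weighted_volume (poisson_kernel x0 t0) O)
             (weighted_volume (poisson_kernel x1 t1) O) <
   weighted_volume
     (poisson_kernel (al *: x0 + be *: x1) (al * t0 + be * t1)) O)%E.
Proof.
move=> oO M0 OM al0 be0 albe cO t00 t10 e1 Ol lO xi.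
have mO := open_measurable_rV oO.
set xl := al *: x0 + be *: x1; set tl := al * t0 + be * t1.
have tl0 : 0 < tl by rewrite addr_gt0// mulr_gt0.
pose D := (e * x1 ord0 i - l) * t0 - (e * x0 ord0 i - l) * t1.
have D0 : 0 < D by rewrite subr_gt0.
(* The minor equals D at y = z = l. Raising z to level b costs at most (b - l) t0 = D / 2, and
   raising y only increases it, so it stays above D / 2 whatever the cut a. *)
pose b := l + D / (2 * t0).
have lb : l < b by rewrite ltrDl divr_gt0// mulr_gt0.
have fin x t (B : set 'rV[R]_n) : 0 < t -> measurable B -> B `<=` O ->
    weighted_volume (poisson_kernel x t) B \is a fin_num.
  move=> t_gt0 mB BO; apply: (weighted_volume_fin OM (K := t / t ^+ n.+1)) => //.
  - exact: measurable_poisson_kernel.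
  - by move=> y; exact: poisson_kernel_ge0.
  - by move=> y; exact: poisson_kernel_le.
have pos x t (B : set 'rV[R]_n) : 0 < t -> open B -> B `<=` O -> B !=set0 ->
    (0 < weighted_volume (poisson_kernel x t) B)%E.
  move=> t_gt0 oB BO B0.
  pose N := \sum_j `|x ord0 j| + M.
  have xN y : B y -> forall j, `|(x - y) ord0 j| <= N.
    move=> /BO Oy j; rewrite !mxE (le_trans (ler_normB _ _))// lerD ?OM//.
    by rewrite (bigD1 j)//= lerDl sumr_ge0.
  apply: lt_le_trans (weighted_volume_ge (k := t / half_norm (const_mx N : 'rV[R]_n) t ^+ n.+1) _ _ _ _ _).
  - by rewrite mule_gt0 ?borel_lebesgue_open_gt0// lte_fin divr_gt0 ?exprn_gt0 ?half_norm_gt0.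
  - exact: measurable_poisson_kernel.
  - by move=> y; exact: poisson_kernel_ge0.
  - exact: open_measurable_rV.
  - by rewrite divr_ge0 ?exprn_ge0 ?sqrtr_ge0// ltW.
  - by move=> y By; apply: poisson_kernel_ge => //; exact: xN.
have mlt a := measurable_slab_lt e i mO a.
have mge a := measurable_slab_ge e i mO a.
have ltO a : slab_lt O e i a `<=` O by move=> y [].
have geO a : slab_ge O e i a `<=` O by move=> y [].
have split x t a : 0 < t -> weighted_volume (poisson_kernel x t) O =
   (weighted_volume (poisson_kernel x t) (slab_lt O e i a) +
    weighted_volume (poisson_kernel x t) (slab_ge O e i a))%E.
  move=> t_gt0; rewrite -weighted_volumeU ?slabU ?slabI//.
  - exact: measurable_poisson_kernel.
  - by move=> y; exact: poisson_kernel_ge0.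
have O0 : O !=set0 by have [y Oy _] := lO b lb; exists y.
have olt : open (slab_lt O e i b).
  apply: openI => //.
  apply: (@open_comp _ _ (fun y : 'rV[R]_n => e * y ord0 i) [set u | u < b]); last exact: open_lt.
  move=> y _; apply: (@continuous_comp _ _ _ (fun z : 'rV[R]_n => z ord0 i) ( *%R e)).
    exact: coord_continuous.
  exact: mulrl_continuous.
have lt0 : slab_lt O e i b !=set0 by have [y Oy yb] := lO b lb; exists y.
set W0 := weighted_volume (poisson_kernel x0 t0) O.
set W1 := weighted_volume (poisson_kernel x1 t1) O.
have W0f : W0 \is a fin_num by exact: fin.
have W1f : W1 \is a fin_num by exact: fin.
have W00 : 0 < fine W0 by rewrite fine_gt0// pos//= ltey_eq W0f.
have W10 : 0 < fine W1 by rewrite fine_gt0// pos//= ltey_eq W1f.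
pose g := weighted_volume (poisson_kernel x1 t1) (slab_lt O e i b).
have gf : g \is a fin_num by apply: fin; [|exact: mlt|exact: ltO].
have g0 : 0 < fine g by rewrite fine_gt0// pos//= ltey_eq gf.
pose g' := weighted_volume (poisson_kernel x1 t1) (slab_ge O e i b).
have g'f : g' \is a fin_num by apply: fin; [|exact: mge|exact: geO].
have g'0 : 0 <= fine g' by rewrite fine_ge0// weighted_volume_ge0// => y; exact: poisson_kernel_ge0.
have W1E : fine W1 = fine g + fine g' by rewrite -fineD//; congr fine; exact: split.
pose s := fine g / fine W1.
have s0 : 0 < s by rewrite divr_gt0.
have s1 : s <= 1 by rewrite ler_pdivrMr// mul1r W1E lerDl.
(* The cut a gives the kernel at (x0, t0) the same fraction s of its mass as b gives the kernel at
   (x1, t1). *)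
have [|a aE] := slab_ivt i mO M0 OM e1 (measurable_poisson_kernel x0 t00)
  (fun y => poisson_kernel_ge0 x0 y t00) (fun y => poisson_kernel_le x0 y t00) (s := s).
  by rewrite (ltW s0).
pose f := weighted_volume (poisson_kernel x0 t0) (slab_lt O e i a).
have ff : f \is a fin_num by apply: fin; [|exact: mlt|exact: ltO].
have fE : fine f = s * fine W0 by rewrite /f aE fineM.
pose f' := weighted_volume (poisson_kernel x0 t0) (slab_ge O e i a).
have f'f : f' \is a fin_num by apply: fin; [|exact: mge|exact: geO].
have W0E : fine W0 = fine f + fine f' by rewrite -fineD//; congr fine; exact: split.
pose c := al * a + be * b.
pose h := weighted_volume (poisson_kernel xl tl) (slab_lt O e i c).
have hf : h \is a fin_num by apply: fin; [|exact: mlt|exact: ltO].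
pose h' := weighted_volume (poisson_kernel xl tl) (slab_ge O e i c).
have h'f : h' \is a fin_num by apply: fin; [|exact: mge|exact: geO].
have conv_coord (y z : 'rV[R]_n) : e * (al *: y + be *: z) ord0 i =
    al * (e * y ord0 i) + be * (e * z ord0 i) by rewrite !mxE; ring.
pose N := \sum_j `|x0 ord0 j| + \sum_j `|x1 ord0 j| + M.
pose K := half_norm (const_mx N : 'rV[R]_n) t0 + half_norm (const_mx N : 'rV[R]_n) t1.
have K0 : 0 < K by rewrite addr_gt0// half_norm_gt0.
have x0N y : O y -> forall j, `|(x0 - y) ord0 j| <= N.
  move=> Oy j; rewrite !mxE (le_trans (ler_normB _ _))// lerD ?OM//.
  rewrite (bigD1 j)//= -addrA lerDl addr_ge0// sumr_ge0//.
have x1N y : O y -> forall j, `|(x1 - y) ord0 j| <= N.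
  move=> Oy j; rewrite !mxE (le_trans (ler_normB _ _))// lerD ?OM//.
  by rewrite addrC (bigD1 j)//= -addrA lerDl addr_ge0// sumr_ge0//.
(* K bounds both norms for y and z in O, and D / 2 is the bound on the minor over the lower slabs,
   so one kap serves all pairs. *)
have [kap /andP[kap0 kap1] kapP] := half_norm_conv_lt i al0 be0 albe K0 (divr_gt0 D0 (@ltr0n R 2)).
pose theta := kap ^+ n.+1.
have theta0 : 0 < theta by rewrite exprn_gt0.
have theta1 : theta < 1 by rewrite exprn_ilt1// ltW.
have lower : Num.min (fine f) (fine g) <= theta * fine h.
  have : (Order.min f g <=
      weighted_volume (fun y => theta * poisson_kernel xl tl y)%R (slab_lt O e i c))%E.
    apply: (weighted_volume_bbl al0 be0) => //.
    - exact: measurable_poisson_kernel.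
    - exact: measurable_poisson_kernel.
    - by apply: measurable_funM => //; exact: measurable_poisson_kernel.
    - by move=> y; exact: poisson_kernel_ge0.
    - by move=> y; exact: poisson_kernel_ge0.
    - by move=> y; rewrite mulr_ge0 ?(ltW theta0)// poisson_kernel_ge0.
    - move=> y z [Oy /= ya] [Oz /= zb]; split; first exact: cO.
      by rewrite /= conv_coord ltrD// ltr_pM2l.
    - move=> y z d P Q [Oy /= ya] [Oz /= zb] d0 P0 Q0; apply: poisson_kernel_bbl => //.
      apply: kapP => //.
      + by apply: (le_trans (half_norm_le _ (x0N y Oy))); rewrite lerDl sqrtr_ge0.
      + by apply: (le_trans (half_norm_le _ (x1N z Oz))); rewrite lerDr sqrtr_ge0.
      have e_norm : `|e| = 1 by apply/eqP; rewrite -(@pexpr_eq1 _ _ 2)// -normrX expr2 e1 normr1.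
      have -> : `|t1 * (x0 - y) ord0 i - t0 * (x1 - z) ord0 i| =
          `|- (e * (t1 * (x0 - y) ord0 i - t0 * (x1 - z) ord0 i))|.
        by rewrite normrN [in RHS]normrM e_norm mul1r.
      apply: le_trans (ler_norm _).
      have -> : - (e * (t1 * (x0 - y) ord0 i - t0 * (x1 - z) ord0 i)) =
        (e * x1 ord0 i - e * z ord0 i) * t0 - (e * x0 ord0 i - e * y ord0 i) * t1.
        by rewrite !mxE; ring.
      have zb' : e * z ord0 i * t0 <= b * t0 by rewrite ler_pM2r// ltW.
      have yl' : l * t1 <= e * y ord0 i * t1 by rewrite ler_pM2r// Ol.
      have bt : b * t0 = l * t0 + D / 2 by rewrite /b; field; rewrite gt_eqF.
      by move: bt zb' yl'; rewrite /D; lra.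
  rewrite weighted_volumeZ ?(ltW theta0)//; last 2 first.
  - exact: measurable_poisson_kernel.
  - by move=> y; exact: poisson_kernel_ge0.
  by rewrite -/h -(fineK ff) -(fineK gf) -(fineK hf) -EFin_min -EFinM lee_fin.
have upper : Num.min (fine f') (fine g') <= fine h'.
  have : (Order.min f' g' <= h')%E.
    apply: (weighted_volume_bbl al0 be0) => //; try exact: measurable_poisson_kernel;
      try by move=> y; exact: poisson_kernel_ge0.
    - move=> y z [Oy /= ya] [Oz /= zb]; split; first exact: cO.
      by rewrite /= conv_coord lerD// ler_pM2l.
    - move=> y z d P Q [Oy _] [Oz _] d0 P0 Q0 HP HQ.
      have := @poisson_kernel_bbl R n al be 1 x0 x1 t0 t1 y z d P Q al0 be0 ltr01 t00 t10 d0 P0 Q0.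
      by rewrite expr1n !mul1r; apply => //; apply: half_norm_conv_le => //; exact: ltW.
  by rewrite -(fineK f'f) -(fineK g'f) -(fineK h'f) -EFin_min lee_fin.
rewrite (split _ _ c tl0) -/h -/h' -(fineK W0f) -(fineK W1f) -(fineK hf) -(fineK h'f).
rewrite -EFin_min -EFinD lte_fin.
set m := Num.min (fine W0) (fine W1).
have m0 : 0 < m by rewrite lt_min W00 W10.
have mW0 : m <= fine W0 by rewrite ge_min lexx.
have mW1 : m <= fine W1 by rewrite ge_min lexx orbT.
have gE : fine g = s * fine W1 by rewrite /s divfK// gt_eqF.
(* Equal fractions make the minima over lower and upper slabs at least s m and (1 - s) m. Adding
   gives m <= theta h + h', which is less than h + h' because h > 0. *)
have sm : s * m <= theta * fine h.
  by apply: le_trans lower; rewrite le_min fE gE !ler_pM2l// mW0 mW1.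
have sm' : (1 - s) * m <= fine h'.
  apply: le_trans upper; rewrite le_min.
  have -> : fine f' = (1 - s) * fine W0 by rewrite mulrBl mul1r -fE W0E; ring.
  have -> : fine g' = (1 - s) * fine W1 by rewrite mulrBl mul1r -gE W1E; ring.
  by rewrite !ler_wpM2l// subr_ge0.
have h0 : 0 < fine h by rewrite -(pmulr_rgt0 _ theta0) (lt_le_trans _ sm)// mulr_gt0.
have : theta * fine h < fine h by rewrite gtr_pMl.
by move: sm sm'; rewrite mulrBl mul1r; lra.
Qed.

(** * The normalising constant and the theorem *)

Lemma cone_sphere (R : realType) (n : nat) :
  cone (sphere R n `&` sphere R n) = [set z | enorm z <= 1].
Proof.
have enormZ (r : R) (x : 'rV[R]_n.+1) : enorm (r *: x) = `|r| * enorm x.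
  rewrite /enorm -sqrtr_sqr -sqrtrM ?sqr_ge0// mulr_sumr; congr Num.sqrt.
  by apply: eq_bigr => i _; rewrite mxE exprMn.
rewrite setIid; apply/seteqP; split => [_ [r [x [/andP[r0 r1] x1 ->]]]|z /= z1].
  by rewrite /= enormZ x1 mulr1 ger0_norm.
have [z0|z0] := eqVneq (enorm z) 0.
  exists 0, (delta_mx ord0 ord0); split; first by rewrite lexx ler01.
    rewrite /sphere/= /enorm (bigD1 ord0)//= mxE !eqxx expr1n big1 ?addr0 ?sqrtr1//.
    by move=> i /negbTE i0; rewrite mxE i0 andbF expr0n.
  rewrite scale0r; apply/rowP => i; rewrite mxE; apply/eqP.
  move: z0 => /eqP; rewrite sqrtr_eq0 => z0; rewrite -sqrf_eq0 eq_le sqr_ge0 andbT.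
  by apply: le_trans z0; rewrite (bigD1 i)//= lerDl sumr_ge0// => j _; rewrite sqr_ge0.
exists (enorm z), ((enorm z)^-1 *: z); split.
- by rewrite sqrtr_ge0 z1.
- by rewrite /sphere/= enormZ ger0_norm ?invr_ge0 ?sqrtr_ge0// mulVf.
- by rewrite scalerA divff// scale1r.
Qed.

(** As [fine] sends +oo to 0, finiteness is part of the claim: the unit ball is bounded, and it
    contains a cube of side 1/(n+1), on which each of the n+1 squares is at most 1/(n+1). *)
Lemma spherical_measure_gt0 (R : realType) (n : nat) :
  0 < fine (spherical_measure (sphere R n)).
Proof.
rewrite /spherical_measure cone_sphere.
set B := [set z : 'rV[R]_n.+1 | _].
have BE : B = [set z | \sum_i z ord0 i ^+ 2 <= 1].
  have sq_ge0 (z : 'rV[R]_n.+1) : 0 <= \sum_i z ord0 i ^+ 2.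
    by rewrite sumr_ge0// => i _; rewrite sqr_ge0.
  rewrite /B; apply/funext => z /=.
  by rewrite -(ler_pXn2r (n:=2)) ?nnegrE ?sqrtr_ge0// expr1n sqr_sqrtr.
have mB : measurable B.
  rewrite (_ : B = (fun z : 'rV[R]_n.+1 => \sum_i z ord0 i ^+ 2) @^-1` `]-oo, 1]).
    rewrite -[X in measurable X]setTI.
    have : measurable_fun setT (fun z : 'rV[R]_n.+1 => \sum_i z ord0 i ^+ 2).
      by apply: measurable_sum => i; apply: measurable_funX; exact: measurable_rV_coord.
    by apply => //; exact: measurable_itv.
  by rewrite BE; apply/seteqP; split => z /=; rewrite in_itv.
rewrite lebesgue_rVE// fine_gt0//; apply/andP; split.
  apply: mule_gt0; first by rewrite lte_fin.
  pose d : R := n.+1%:R^-1.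
  have d0 : 0 < d by rewrite invr_gt0.
  have d1 : d <= 1 by rewrite invf_le1// ler1n.
  apply: (@lt_le_trans _ _ (borel_lebesgue_rV R n.+1
      [set z | forall i, (0 : R) <= z ord0 i < d])).
    rewrite (@borel_lebesgue_box _ _ (fun=> 0) (fun=> d)); last by move=> i; exact: ltW.
    by rewrite lte_fin prodr_gt0// => i _; rewrite subr0.
  apply: le_measure; rewrite ?inE//; first exact: (measurable_rV_box (fun=> 0) (fun=> d)).
  rewrite BE => z zd /=; apply: (@le_trans _ _ (\sum_(i < n.+1) d)).
    apply: ler_sum => i _; have /andP[z0 zd'] := zd i.
    by rewrite expr2 (le_trans _ (ltW zd'))// ler_piMl// (le_trans (ltW zd')).
  by rewrite sumr_const card_ord -mulr_natr mulVf// pnatr_eq0.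
apply: lte_mul_pinfty => //.
apply: (@borel_lebesgue_bounded _ _ _ 1) => // z; rewrite BE => z1 i.
rewrite -sqrtr_sqr -[leRHS]sqrtr1 ler_wsqrtr// (le_trans _ z1)// (bigD1 i)//= lerDl.
by rewrite sumr_ge0// => j _; rewrite sqr_ge0.
Qed.

Lemma poisson_integral_indicE (R : realType) (n : nat) (Omega : set 'rV[R]_n) x t :
  bounded_set Omega -> convex_set (Omega : set (convex_lmodType 'rV[R]_n)) ->
  Omega° !=set0 -> 0 < t ->
  poisson_integral \1_Omega x t = 2 / fine (spherical_measure (sphere R n)) *
    fine (weighted_volume (poisson_kernel x t) Omega°).
Proof.
move=> bO cO O0 t0; rewrite /poisson_integral /Rintegral.
have := spherical_measure_gt0 R n.
move: (fine (spherical_measure _)) => sigma sigma0.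
(* The integrand of [poisson_integral]: there the factor t of the kernel stands outside the
   integral. *)
pose G y := t^-1 * poisson_kernel x t y.
have mG : measurable_fun setT G by apply: measurable_funM => //; exact: measurable_poisson_kernel.
have G0 y : 0 <= G y by rewrite mulr_ge0 ?poisson_kernel_ge0// invr_ge0 ltW.
have mO := measurable_interior_rV Omega.
have [M M0 OM] := bounded_setP bO.
rewrite (_ : integral _ _ _ = weighted_volume G Omega°); last first.
  rewrite /weighted_volume -(integral_convex_body bO cO O0 mG G0).
  apply: eq_integral => y _; congr (_ * _)%:E.
  by rewrite /G poisson_kernelE// mulKf// gt_eqF.
rewrite /G weighted_volumeZ//; last 3 first.
- exact: measurable_poisson_kernel.
- by move=> y; exact: poisson_kernel_ge0.
- by rewrite invr_ge0 ltW.
rewrite fineM//; last first.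
  apply: (@weighted_volume_fin _ _ Omega M OM _ (t / t ^+ n.+1)) => //.
  - exact: measurable_poisson_kernel.
  - by move=> y; exact: poisson_kernel_ge0.
  - by move=> y; exact: poisson_kernel_le.
  - exact: interior_subset.
by rewrite /=; field; rewrite gt_eqF//= gt_eqF.
Qed.

Theorem proposition3p14 (R : realType) (n : nat) (n_gt0 : (0 < n)%N)
    (Omega : set 'rV[R]_n) (Omega_bounded : bounded_set Omega)
    (Omega_convex : convex_set (Omega : set (convex_lmodType 'rV[R]_n)))
    (Omega_interior : Omega° !=set0) :
  strictly_parabolically1_quasi_concave (poisson_integral \1_Omega).
Proof.
have [M M0 OM] := bounded_setP Omega_bounded.
set O : set 'rV[R]_n := Omega°.
have oO : open O by exact: open_interior.
have {}OM y : O y -> forall j, `|y ord0 j| <= M by move=> /interior_subset; exact: OM.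
have sigma0 := spherical_measure_gt0 R n.
have PE x t : 0 < t -> poisson_integral \1_Omega x t =
    2 / fine (spherical_measure (sphere R n)) * fine (weighted_volume (poisson_kernel x t) O).
  exact: poisson_integral_indicE.
have strict (x0 x1 : 'rV[R]_n) (t0 t1 lambda : R) :
    0 < t0 -> 0 < t1 -> (x0, t0) <> (x1, t1) -> 0 < lambda < 1 ->
    Num.min (poisson_integral \1_Omega x0 t0) (poisson_integral \1_Omega x1 t1) <
    poisson_integral \1_Omega ((1 - lambda) *: x0 + lambda *: x1)
      ((1 - lambda) * t0 + lambda * t1).
  move=> t00 t10 neq /andP[l0 l1].
  have l1' : 0 < 1 - lambda by rewrite subr_gt0.
  have cO (al be : R) : 0 < al -> 0 < be -> al + be = 1 ->
      forall y z, O y -> O z -> O (al *: y + be *: z).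
    move=> al0 be0 albe y z Oy Oz; have -> : al = 1 - be by rewrite -albe addrK.
    apply: segment_interior => //; first by rewrite be0 -albe lerDr ltW.
    by apply: subset_closure; exact: interior_subset.
  pose img (i : 'I_n) (e : R) : set R := [set e * y ord0 i | y in O].
  have img0 i e : img i e !=set0 by have [y Oy] := Omega_interior; exists (e * y ord0 i), y.
  have imgb i e : has_inf (img i e).
    split; first exact: img0.
    exists (- (`|e| * M)) => _ [y Oy <-]; rewrite lerNl.
    by rewrite (le_trans (ler_norm _))// normrN normrM ler_wpM2l// OM.
  have inf_le i e y : O y -> inf (img i e) <= e * y ord0 i.
    by move=> Oy; apply: ge_inf; [case: (imgb i e)|exists y].
  have inf_lt i e b : inf (img i e) < b -> exists2 y, O y & e * y ord0 i < b.
    rewrite -subr_gt0 => ib; have [_ [y Oy <-] yb] := inf_adherent ib (imgb i e).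
    by exists y => //; move: yb; rewrite addrC subrK.
  have fin x t : 0 < t -> weighted_volume (poisson_kernel x t) O \is a fin_num.
    move=> t_gt0; apply: (weighted_volume_fin OM (K := t / t ^+ n.+1)) => //.
    - exact: measurable_poisson_kernel.
    - by move=> y; exact: poisson_kernel_ge0.
    - by move=> y; exact: poisson_kernel_le.
    - exact: open_measurable_rV.
  have tl0 : 0 < (1 - lambda) * t0 + lambda * t1 by rewrite addr_gt0// mulr_gt0.
  rewrite !PE// -minr_pMr; last by rewrite divr_ge0// ltW.
  rewrite ltr_pM2l ?divr_gt0// -lte_fin EFin_min !fineK ?fin//.
  (* If equality held for every axis and sign, adding the equations for e = 1 and e = -1 would give
     (t0 - t1) times the width of a projection of O equal to 0. The width is positive, so t0 = t1,
     and then each coordinate of x0 equals that of x1. *)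
  have [i [e [e1 ne]]] : exists i e, e * e = 1 /\
     (e * x0 ord0 i - inf (img i e)) * t1 != (e * x1 ord0 i - inf (img i e)) * t0.
    apply: contrapT => nex; apply: neq.
    have all_eq i e : e * e = 1 ->
        (e * x0 ord0 i - inf (img i e)) * t1 = (e * x1 ord0 i - inf (img i e)) * t0.
      move=> e1; apply/eqP/negPn/negP => ne; apply: nex; exists i, e; split => //.
    (* This sum is minus the width of the i-th projection of O; moving an interior point by r / 2
       both ways shows that it is negative. *)
    have width i : inf (img i 1) + inf (img i (- 1)) < 0.
      have [y Oy] := Omega_interior.
      have /nbhs_ballP[r /= r0 yrO] : nbhs y O by exact: open_nbhs_nbhs.
      have Oyr (u : R) : `|u| < r -> O (y + const_mx u).
        move=> ur; apply: yrO; apply/rV_ballP => // j; rewrite !mxE.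
        by rewrite opprD addrA subrr sub0r normrN.
      have r2 : `|r / 2| < r by rewrite ger0_norm ?ltr_pdivrMr//; lra.
      have := inf_le i 1 _ (Oyr (- (r / 2)) _); rewrite normrN => /(_ r2).
      have := inf_le i (- 1) _ (Oyr (r / 2) r2).
      by rewrite !mxE; lra.
    have N11 : - 1 * - 1 = 1 :> R by rewrite mulrNN mulr1.
    have t01 : t0 = t1.
      pose i := Ordinal n_gt0.
      have := all_eq i 1 (mulr1 _); have := all_eq i (- 1) N11.
      have := width i; set a := inf _; set b := inf _ => ab E1 E2.
      have : (a + b) * (t0 - t1) = 0 by move: E1 E2; lra.
      by move=> /eqP; rewrite mulf_eq0 lt_eqF//= subr_eq0 => /eqP.
    rewrite -t01; congr pair; apply/rowP => i.
    have := all_eq i 1 (mulr1 _); rewrite -t01 => /(mulIf (lt0r_neq0 t00)).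
    by rewrite !mul1r => /addIr.
  have [lt|gt|eq] := ltgtP ((e * x0 ord0 i - inf (img i e)) * t1)
                       ((e * x1 ord0 i - inf (img i e)) * t0).
  - apply: (poisson_volume_strict (M := M) (l := inf (img i e)) (e := e) (i := i)) => //.
    + by rewrite subrK.
    + by apply: cO => //; rewrite subrK.
    + by move=> y; exact: inf_le.
    + by move=> b; exact: inf_lt.
  (* The reverse inequality is the same situation with the two points exchanged. *)
  - rewrite minC [_ *: x0 + _]addrC [_ * t0 + _]addrC.
    apply: (poisson_volume_strict (M := M) (l := inf (img i e)) (e := e) (i := i)) => //.
    + by rewrite addrC subrK.
    + by apply: cO => //; rewrite addrC subrK.
    + by move=> y; exact: inf_le.
    + by move=> b; exact: inf_lt.
  - by move: ne; rewrite eq eqxx.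
split; last exact: strict.
split=> [x t t0|x0 x1 t0 t1 lambda t00 t10 /andP[l0 l1]].
  rewrite PE// mulr_ge0 ?divr_ge0 ?(ltW sigma0)// fine_ge0// weighted_volume_ge0// => y.
  exact: poisson_kernel_ge0.
(* The weak inequality follows from the strict one once equal points and the endpoints lambda = 0, 1
   are set apart. *)
have [[-> ->]|neq] := pselect ((x0, t0) = (x1, t1)).
  by rewrite -scalerDl -mulrDl subrK scale1r mul1r ge_min lexx.
have [->|ln0] := eqVneq lambda 0.
  by rewrite subr0 !scale1r !mul1r scale0r mul0r !addr0 ge_min lexx.
have [->|ln1] := eqVneq lambda 1.
  by rewrite subrr !scale0r !mul0r scale1r mul1r !add0r ge_min lexx orbT.
by apply/ltW/strict => //; rewrite lt_def ln0 l0 lt_def eq_sym ln1 l1.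
Qed.
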